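(* Let $\mathbb{X}$ be either $\mathbb{R}^{n\times m}$ (with $n\le m$) or $\mathbb{S}^n$. Let $g:\mathbb{R}^n\to(-\infty,+\infty]$ be a proper closed convex and absolutely symmetric function, and let $\theta:\mathbb{X}\to(-\infty,+\infty]$ be the spectral function $\theta(X)=g(\sigma(X))$, $X\in\mathbb{X}$. Let $(\overline{X},\overline{W})\in\mathrm{gph}\,\partial\theta$. If the subdifferential mapping $\partial g$ is metrically subregular at $\sigma(\overline{X})$ for $\sigma(\overline{W})$, then the subdifferential mapping $\partial\theta$ is metrically subregular at $\overline{X}$ for $\overline{W}$.
   Context: $\mathbb{S}^n$ is the space of real symmetric $n\times n$ matrices; matrix spaces carry the trace inner product and the Frobenius norm. $\sigma(X)\in\mathbb{R}^n$ is the vector of singular values of $X\in\mathbb{X}$ in non-increasing order. $g$ is absolutely symmetric if $g(x)=g(Qx)$ for every $x\in\mathbb{R}^n$ and every signed permutation matrix $Q$ (each row and each column has exactly one nonzero entry, which is $\pm1$). $\partial$ is the subdifferential of convex analysis. Metric subregularity: for a set-valued mapping $G:\mathbb{U}\rightrightarrows\mathbb{V}$ between finite dimensional Euclidean spaces, with $\mathrm{gph}\,G=\{(u,v)\mid v\in G(u)\}$ and $G^{-1}(v)=\{u\mid v\in G(u)\}$, $G$ is metrically subregular at $\bar u$ for $\bar v$ if $(\bar u,\bar v)\in\mathrm{gph}\,G$ and there exist $\delta>0$, $\varepsilon>0$, $\kappa>0$ such that $\mathrm{dist}(u,G^{-1}(\bar v))\le\kappa\,\mathrm{dist}(\bar v,G(u)\cap\mathbb{B}_\delta(\bar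 v))$ for all $u\in\mathbb{B}_\varepsilon(\bar u)$, where $\mathbb{B}_\rho(u)$ is the closed ball of radius $\rho$ centered at $u$, and the distance to the empty set is $+\infty$. *)

(* Defs.v *)
From HB Require Import structures.
From mathcomp Require Import all_boot all_order all_algebra.
From mathcomp Require Import all_classical all_reals all_analysis.
From mathcomp Require complex.

Set Implicit Arguments.
Unset Strict Implicit.
Unset Printing Implicit Defensive.

Import Order.TTheory GRing.Theory Num.Theory.
Import numFieldNormedType.Exports.

Local Open Scope classical_set_scope.
Local Open Scope ring_scope.

HB.mixin Record isEuclidean (R : realType) (E : Type) of Vector R E := {
  inner : E -> E -> R ;
  innerC : forall x y, inner x y = inner y x ;
  inner_linearl : forall a x y z, inner (a *: x + y) z = a * inner x z + inner y z ;
  inner_gt0 : forall x, x != 0 -> 0 < inner x x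
}.

#[short(type="euclidType")]
HB.structure Definition Euclidean (R : realType) :=
  {E of Vector R E & isEuclidean R E}.

Section MatrixSpaces.
Variable R : realType.

Section TraceInner.
Variables p q : nat.
Implicit Types A B C : 'M[R]_(p, q).

Definition trace_inner A B : R := \tr (A^T *m B).

Lemma trace_innerC A B : trace_inner A B = trace_inner B A.
Proof. by rewrite /trace_inner -mxtrace_tr trmx_mul trmxK. Qed.

Lemma trace_inner_linearl a A B C :
  trace_inner (a *: A + B) C = a * trace_inner A C + trace_inner B C.
Proof.
by rewrite /trace_inner linearP mulmxDl -scalemxAl mxtraceD mxtraceZ.
Qed.

Lemma trace_inner_gt0 A : A != 0 -> 0 < trace_inner A A.
Proof.
have ge0 j i : 0 <= A^T j i * A i j by rewrite mxE -expr2 sqr_ge0.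
have ge0' j : 0 <= (A^T *m A) j j by rewrite mxE sumr_ge0.
move=> A0; rewrite lt_neqAle sumr_ge0 // andbT eq_sym.
apply: contra A0; rewrite /trace_inner /mxtrace psumr_eq0 // => /allP h.
apply/eqP/matrixP => i j; rewrite mxE.
have := h j (mem_index_enum _); rewrite mxE /= psumr_eq0 // => /allP /(_ i).
by rewrite mem_index_enum mxE -expr2 sqrf_eq0 => /(_ isT) /eqP.
Qed.

HB.instance Definition _ :=
  isEuclidean.Build R 'M[R]_(p, q)
    trace_innerC trace_inner_linearl trace_inner_gt0.

End TraceInner.

Section Subspace.
Variables (E : euclidType R) (U : {vspace E}).

Definition subspace_inner (x y : subvs_of U) : R := inner (vsval x) (vsval y).

Lemma subspace_innerC x y : subspace_inner x y = subspace_inner y x.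
Proof. exact: innerC. Qed.

Lemma subspace_inner_linearl a x y z :
  subspace_inner (a *: x + y) z = a * subspace_inner x z + subspace_inner y z.
Proof. by rewrite /subspace_inner linearP inner_linearl. Qed.

Lemma subspace_inner_gt0 x : x != 0 -> 0 < subspace_inner x x.
Proof.
by move=> x0; apply: inner_gt0; apply: contra x0 => /eqP h; apply/eqP/val_inj.
Qed.

HB.instance Definition _ :=
  isEuclidean.Build R (subvs_of U)
    subspace_innerC subspace_inner_linearl subspace_inner_gt0.

End Subspace.

Definition symm_space (n : nat) : {vspace 'M[R]_n} :=
  fixedSpace (linfun (@trmx R n n)).

Lemma symm_spaceP n (X : 'M[R]_n) : reflect (X^T = X) (X \in symm_space n).
Proof. by apply: (iffP fixedSpaceP); rewrite lfunE. Qed.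

End MatrixSpaces.

Notation symmx R n := (subvs_of (symm_space R n)).

Section ConvexAnalysis.
Variables (R : realType) (E : euclidType R).
Implicit Types (f : E -> \bar R) (A : set E) (x y : E).

Definition enorm x : R := Num.sqrt (inner x x).

Definition eball x (r : R) : set E := [set y | enorm (y - x) <= r].

(* ereal_inf set0 = +oo, so dist x set0 = +oo. *)
Definition dist x A : \bar R := ereal_inf [set (enorm (x - y))%:E | y in A].

Definition proper_fun f : Prop :=
  (forall x, (-oo < f x)%E) /\ (exists x, (f x < +oo)%E).

(* Restricting to 0 < t < 1 loses nothing.  For a proper f the right-hand side
   never has the form +oo + -oo. *)
Definition convex_fun f : Prop :=
  forall x y (t : R), 0 < t -> t < 1 ->
    (f (t *: x + (1 - t) *: y)%R <= t%:E * f x + (1 - t)%:E * f y)%E.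

Definition subdifferential f x : set E :=
  [set w | forall y, (f x + (inner w (y - x)%R)%:E <= f y)%E].

End ConvexAnalysis.

(* Closedness means closedness of the epigraph.  The library topology on matrices
   comes from the entrywise maximum norm and coincides with the Euclidean one. *)
Definition closed_fun (R : realType) n (f : 'cV[R]_n -> \bar R) : Prop :=
  closed [set z : 'cV[R]_n * R | (f z.1 <= z.2%:E)%E].

Definition metrically_subregular (R : realType) (U V : euclidType R)
    (G : U -> set V) (ubar : U) (vbar : V) : Prop :=
  G ubar vbar /\
  exists delta eps kappa : R,
    [/\ 0 < delta, 0 < eps, 0 < kappa &
      forall u, eball ubar eps u ->
        (dist u [set u' | G u' vbar] <=
           kappa%:E * dist vbar (G u `&` eball vbar delta))%E].

Section GramMatrix.
Variable R : realType.

Import complex.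

Lemma char_poly_gram n m (X : 'M[R]_(n, m)) :
  exists2 r : seq R, size r = n /\ all (>= 0) r &
    char_poly (X *m X^T) = \prod_(x <- r) ('X - x%:P).
Proof.
set A := X *m X^T.
have AT : A^T = A by rewrite trmx_mul trmxK.
pose C : numClosedFieldType := complex.complex R.
pose c : {rmorphism R -> C} := complex.real_complex R.
pose Ac : 'M[C]_n := map_mx c A.
have Acsym : Ac \is hermsymmx.
  apply: realsym_hermsym.
    by apply/is_hermitianmxP; rewrite expr0 scale1r map_mx_id // map_trmx AT.
  apply/mxOverP => i j; rewrite mxE; apply/complex.complex_realP.
  by exists (A i j).
have := hermitian_normalmx Acsym => /orthomx_spectralP.
have := hermitian_spectral_diag_real Acsym.
have := spectral_unit Ac.
set P := spectralmx Ac; set d := spectral_diag Ac => Pu dreal AcE.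
pose r := [seq complex.Re (d 0 i) | i <- index_enum 'I_n].
have charE : char_poly A = \prod_(x <- r) ('X - x%:P).
  apply: (map_poly_inj c); rewrite map_char_poly -/Ac AcE.
  have -> : char_poly (invmx P *m diag_mx d *m P) = char_poly (diag_mx d).
    rewrite /char_poly /char_poly_mx !map_mxM /=.
    set Q := map_mx _ (invmx P); set Q' := map_mx _ P.
    have QQ' : Q *m Q' = 1%:M by rewrite -map_mxM mulVmx // map_mx1.
    have XE : 'X%:M = Q *m 'X%:M *m Q' :> 'M[{poly C}]_n.
      by rewrite scalar_mxC -mulmxA QQ' mulmx1.
    rewrite [in LHS]XE -mulmxBl -mulmxBr !det_mulmx [LHS]mulrC mulrA.
    by rewrite -det_mulmx (mulmx1C QQ') det1 mul1r.
  rewrite char_poly_trig ?diag_mx_is_trig //.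
  rewrite rmorph_prod big_map; apply: eq_bigr => i _.
  rewrite rmorphB /= map_polyX map_polyC mxE eqxx mulr1n.
  by congr (_ - _%:P); rewrite /=; apply/esym/RRe_real/(mxOverP dreal).
exists r => //; split.
  by rewrite size_map -[index_enum _]enumT size_enum_ord.
apply/allP => x xr.
have : eigenvalue A x.
  by rewrite eigenvalue_root_char charE root_prod_XsubC.
move=> /eigenvalueP [v vA v0].
have sq k (u : 'rV[R]_k) : (u *m u^T) 0 0 = \sum_i u 0 i ^+ 2.
  by rewrite mxE; apply: eq_bigr => i _; rewrite mxE expr2.
have : x * (v *m v^T) 0 0 = ((v *m X) *m (v *m X)^T) 0 0.
  by rewrite trmx_mul !mulmxA -(mulmxA v) vA -scalemxAl [in RHS]mxE.
rewrite !sq => h.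
have vpos : 0 < \sum_i v 0 i ^+ 2.
  have ge0 : 0 <= \sum_i v 0 i ^+ 2 by apply: sumr_ge0 => i _; apply: sqr_ge0.
  rewrite lt_neqAle ge0 andbT eq_sym; apply: contra v0.
  rewrite psumr_eq0 => [/allP vz|i _]; last exact: sqr_ge0.
  apply/eqP/rowP => i; rewrite mxE; apply/eqP.
  by have := vz i (mem_index_enum _); rewrite sqrf_eq0.
rewrite -(pmulr_lge0 _ vpos) h; apply: sumr_ge0 => i _; exact: sqr_ge0.
Qed.

End GramMatrix.

Section Spectral.
Variable R : realType.

Definition signed_perm_mx n (Q : 'M[R]_n) : Prop :=
  [/\ forall i, exists! j, Q i j != 0,
      forall j, exists! i, Q i j != 0 &
      forall i j, Q i j != 0 -> Q i j = 1 \/ Q i j = -1].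

Definition absolutely_symmetric n (g : 'cV[R]_n -> \bar R) : Prop :=
  forall (x : 'cV[R]_n) (Q : 'M[R]_n), signed_perm_mx Q -> g x = g (Q *m x).

(* The squares of the singular values of X are the eigenvalues of X X^T, counted
   with multiplicity.  When n <= m (in particular for square X) these n numbers
   are the singular values of X. *)
Definition is_singular_values n m (X : 'M[R]_(n, m)) (s : 'cV[R]_n) : Prop :=
  [/\ forall i, 0 <= s i 0,
      forall i j : 'I_n, (i <= j)%N -> s j 0 <= s i 0 &
      char_poly (X *m X^T) = \prod_(i < n) ('X - (s i 0 ^+ 2)%:P)].

Definition singular_values n m (X : 'M[R]_(n, m)) : 'cV[R]_n :=
  xget 0 [set s | is_singular_values X s].

Lemma singular_valuesP n m (X : 'M[R]_(n, m)) :
  is_singular_values X (singular_values X).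
Proof.
have [r [rn /allP r0] rE] := char_poly_gram X.
pose s := sort >=%R (map Num.sqrt r).
have sn : size s = n by rewrite size_sort size_map.
apply: (xgetPex 0); exists (\col_i nth 0 s i); split=> [i|i j ij|].
- rewrite mxE; have /(mem_nth 0) : (i < size s)%N by rewrite sn.
  by rewrite mem_sort => /mapP[x _ ->]; exact: sqrtr_ge0.
- rewrite !mxE; apply: (@sorted_leq_nth _ >=%R) => //.
  + exact: ge_trans.
  + exact: lexx.
  + by apply: sort_sorted => x y; exact: ge_total.
  + by rewrite inE sn.
  + by rewrite inE sn.
transitivity (\prod_(x <- s) ('X - (x ^+ 2)%:P)).
  rewrite rE [RHS](perm_big (map Num.sqrt r)) /=; last by rewrite perm_sort.
  by rewrite big_map !big_seq; apply: eq_bigr => x /r0 x0; rewrite sqr_sqrtr.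
rewrite (big_nth 0) sn big_mkord; apply: eq_bigr => i _; by rewrite mxE.
Qed.

Lemma singular_values_uniq n m (X : 'M[R]_(n, m)) s t :
  is_singular_values X s -> is_singular_values X t -> s = t.
Proof.
move=> [s0 sm sE] [t0 tm tE].
pose sq (u : 'cV[R]_n) := [seq u i 0 | i <- enum 'I_n].
have prodE (u : 'cV[R]_n) : \prod_(i < n) ('X - (u i 0 ^+ 2)%:P) =
    \prod_(x <- map (fun x => x ^+ 2) (sq u)) ('X - x%:P) :> {poly R}.
  by rewrite !big_map -big_enum.
have sqs (u : 'cV[R]_n) : (forall i, 0 <= u i 0) ->
    map Num.sqrt (map (fun x => x ^+ 2) (sq u)) = sq u.
  move=> u0; rewrite -map_comp -[RHS]map_id; apply/eq_in_map => _ /mapP[i _ ->].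
  by rewrite /= sqrtr_sqr ger0_norm.
have srt (u : 'cV[R]_n) : (forall i j : 'I_n, (i <= j)%N -> u j 0 <= u i 0) ->
    sorted >=%R (sq u).
  move=> um; rewrite sorted_map.
  apply: (@sub_sorted _ (relpre val leq)) => [i j /um //|].
  by rewrite -sorted_map val_enum_ord iota_sorted.
have sq_eq : sq s = sq t.
  apply: (@sorted_eq _ >=%R) (srt _ sm) (srt _ tm) _.
  - exact: ge_trans.
  - by move=> x y /andP[xy yx]; apply/le_anti/andP.
  rewrite -(sqs _ s0) -(sqs _ t0); apply/perm_map/prod_XsubC_eq.
  by rewrite -!prodE -sE.
apply/colP => i; move/eq_in_map: sq_eq; apply; exact: mem_enum.
Qed.

Definition spectral_fun n m (g : 'cV[R]_n -> \bar R) (X : 'M[R]_(n, m)) :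
    \bar R :=
  g (singular_values X).

Definition spectral_fun_symm n (g : 'cV[R]_n -> \bar R) (X : symmx R n) :
    \bar R :=
  g (singular_values (vsval X)).

End Spectral.

(* Main.v *)
Require Import Defs.
From mathcomp Require Import all_boot all_order all_algebra.
From mathcomp Require Import fingroup perm.
From mathcomp Require Import all_classical all_reals all_analysis.
From mathcomp Require Import ring lra.

(** The idea is to lift a preimage found for the subdifferential of g in R^n to a
    preimage for the spectral function, keeping the bases fixed, and then to correct
    the bases by a small rotation.

    If W is a subgradient of the spectral function at X, then the singular values
    w of W form a subgradient of g at the singular values x of X, and <X, W> = <x, w>
    ([subgradient_singular_values]).  This is equality in von Neumann's inequality,
    so X and W have a common decomposition X = U D(x) V^T, W = U D(w) V^T
    ([simultaneous_svd]).  Conversely, whenever w is a subgradient of g at some x',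
    U D(w) V^T is a subgradient at U D(x') V^T ([subgradient_factored]).

    Let now X be close to Xbar and W close to Wbar, and let wbar be the vector of
    singular values of Wbar.  Singular values are Lipschitz continuous with constant
    one, so the subregularity of the subdifferential of g yields x' with wbar a
    subgradient at x' and |x - x'| <= k |w - wbar| <= k |W - Wbar|.  Hence
    W' = U D(wbar) V^T is a subgradient at X' = U D(x') V^T, the distance from X to
    X' is at most k |W - Wbar|, and that from W' to Wbar at most 2 |W - Wbar|.

    The matrices W' and Wbar have the same singular values and are close, so there
    are orthogonal H, K with H W' K^T = Wbar which differ from the identity by at
    most C |W' - Wbar|, where C depends on Wbar only ([rect_rotation]).  Then Wbar
    is a subgradient at H X' K^T, which is within O(|W - Wbar|) of X
    ([subregular_transfer]).

    The rotation is first built for symmetric matrices ([rotation]), as the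
    orthogonal polar factor of a matrix which intertwines the eigenspaces of the two
    matrices and is close to the identity.  It passes to rectangular matrices
    through the symmetric dilation with blocks 0, W, W^T, 0.  In the space of
    symmetric matrices all the factors are of the form (U, U D(e)) with signs e
    ([symmetric_svd]), and H = K ([symm_rotation]), so the construction stays in
    that space. *)

Set Implicit Arguments.
Unset Strict Implicit.
Unset Printing Implicit Defensive.

Import Order.TTheory GRing.Theory Num.Theory.

Local Open Scope ring_scope.

(** * Euclidean spaces *)

Section EuclideanSpace.
Variables (R : realType) (E : euclidType R).
Implicit Types x y z : E.

Lemma innerDl x y z : inner (x + y) z = inner x z + inner y z.
Proof. by have := inner_linearl 1 x y z; rewrite scale1r mul1r. Qed.

Lemma inner0l z : inner (0 : E) z = 0.
Proof. by apply: (addrI (inner 0 z)); rewrite -innerDl !addr0. Qed.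

Lemma innerZl (a : R) x z : inner (a *: x) z = a * inner x z.
Proof. by have := inner_linearl a x 0 z; rewrite inner0l !addr0. Qed.

Lemma innerBl x y z : inner (x - y) z = inner x z - inner y z.
Proof. by rewrite innerDl -scaleN1r innerZl mulN1r. Qed.

Lemma innerDr z x y : inner z (x + y) = inner z x + inner z y.
Proof. by rewrite innerC innerDl !(innerC z). Qed.

Lemma innerBr z x y : inner z (x - y) = inner z x - inner z y.
Proof. by rewrite innerC innerBl !(innerC z). Qed.

Lemma inner_ge0 x : 0 <= inner x x.
Proof.
have [->|/inner_gt0/ltW//] := eqVneq x 0; by rewrite inner0l.
Qed.

Lemma inner_eq0 x : inner x x = 0 -> x = 0.
Proof.
move=> xx; apply/eqP; apply: contraTT isT => /inner_gt0.
by rewrite xx ltxx.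
Qed.

Lemma enorm_ge0 x : 0 <= enorm x.
Proof. exact: sqrtr_ge0. Qed.

Lemma sqr_enorm x : enorm x ^+ 2 = inner x x.
Proof. by rewrite /enorm sqr_sqrtr // inner_ge0. Qed.

Lemma sqr_enormB x y :
  enorm (x - y) ^+ 2 = enorm x ^+ 2 + enorm y ^+ 2 - 2 * inner x y.
Proof. by rewrite !sqr_enorm innerBl !innerBr (innerC y x); lra. Qed.

Lemma sqr_enormD x y :
  enorm (x + y) ^+ 2 = enorm x ^+ 2 + enorm y ^+ 2 + 2 * inner x y.
Proof. by rewrite !sqr_enorm innerDl !innerDr (innerC y x); lra. Qed.

Lemma enorm_le x y : inner x x <= inner y y -> enorm x <= enorm y.
Proof. exact: ler_wsqrtr. Qed.

Lemma enormZ (a : R) x : enorm (a *: x) = `|a| * enorm x.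
Proof.
by rewrite /enorm innerZl innerC innerZl mulrA -expr2 sqrtrM ?sqr_ge0 // sqrtr_sqr.
Qed.

Lemma enorm0 : enorm (0 : E) = 0.
Proof. by rewrite /enorm inner0l sqrtr0. Qed.

Lemma enormN x : enorm (- x) = enorm x.
Proof. by rewrite -scaleN1r enormZ normrN1 mul1r. Qed.

Lemma enorm_distC x y : enorm (x - y) = enorm (y - x).
Proof. by rewrite -opprB enormN. Qed.

Lemma enorm0_eq0 x : enorm x = 0 -> x = 0.
Proof. by move=> x0; apply: inner_eq0; rewrite -sqr_enorm x0 expr0n. Qed.

Lemma cauchy_schwarz x y : inner x y <= enorm x * enorm y.
Proof.
have [/enorm0_eq0 ->|x0] := eqVneq (enorm x) 0.
  by rewrite inner0l mulr_ge0 ?enorm_ge0.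
have [/enorm0_eq0 ->|y0] := eqVneq (enorm y) 0.
  by rewrite innerC inner0l mulr_ge0 ?enorm_ge0.
have xp : 0 < enorm x by rewrite lt_def x0 enorm_ge0.
have yp : 0 < enorm y by rewrite lt_def y0 enorm_ge0.
have := inner_ge0 (enorm y *: x - enorm x *: y).
rewrite innerBl !innerBr !innerZl !(innerC _ (_ *: _)) !innerZl (innerC y x).
rewrite -!sqr_enorm => h.
have : 0 <= (2 * (enorm x * enorm y)) * (enorm x * enorm y - inner x y) by nra.
by rewrite pmulr_rge0 ?subr_ge0 // !mulr_gt0.
Qed.

Lemma enorm_triangle x y : enorm (x + y) <= enorm x + enorm y.
Proof.
rewrite -(@ler_pXn2r _ 2) ?nnegrE ?addr_ge0 ?enorm_ge0 //.
by rewrite sqr_enormD; have := cauchy_schwarz x y; nra.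
Qed.

Lemma enorm_triangleB y x z : enorm (x - z) <= enorm (x - y) + enorm (y - z).
Proof.
have -> : x - z = (x - y) + (y - z) by rewrite addrA subrK.
exact: enorm_triangle.
Qed.

End EuclideanSpace.

(** * Frobenius norm and orthogonal matrices *)

Section Orthogonal.
Variable R : realType.

Definition orthogonal_mx n (U : 'M[R]_n) := U^T *m U = 1%:M.

Lemma orthogonal_mxT n (U : 'M[R]_n) : orthogonal_mx U -> U *m U^T = 1%:M.
Proof. exact: mulmx1C. Qed.

Lemma orthogonal_tr n (U : 'M[R]_n) : orthogonal_mx U -> orthogonal_mx U^T.
Proof. by move=> /orthogonal_mxT; rewrite /orthogonal_mx trmxK. Qed.

Lemma orthogonal1 n : orthogonal_mx (1%:M : 'M[R]_n).
Proof. by rewrite /orthogonal_mx trmx1 mulmx1. Qed.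

Lemma orthogonalM n (U V : 'M[R]_n) :
  orthogonal_mx U -> orthogonal_mx V -> orthogonal_mx (U *m V).
Proof.
rewrite /orthogonal_mx => UU VV.
by rewrite trmx_mul -mulmxA (mulmxA U^T) UU mul1mx.
Qed.

Lemma innerE p q (A B : 'M[R]_(p, q)) : inner A B = \tr (A^T *m B).
Proof. by []. Qed.

Lemma inner_sum p q (A B : 'M[R]_(p, q)) :
  inner A B = \sum_i \sum_j A i j * B i j.
Proof.
rewrite innerE /mxtrace exchange_big /=; apply: eq_bigr => j _.
by rewrite mxE; apply: eq_bigr => i _; rewrite mxE.
Qed.

Lemma inner_col p (x y : 'cV[R]_p) : inner x y = \sum_i x i 0 * y i 0.
Proof. by rewrite inner_sum; apply: eq_bigr => i _; rewrite big_ord1. Qed.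

Lemma inner_tr p q (A B : 'M[R]_(p, q)) : inner A^T B^T = inner A B.
Proof. by rewrite !innerE trmxK mxtrace_mulC -mxtrace_tr trmx_mul trmxK. Qed.

Lemma inner_mulmxl p q r (U : 'M[R]_(p, q)) (A : 'M[R]_(q, r)) B :
  inner (U *m A) B = inner A (U^T *m B).
Proof. by rewrite !innerE trmx_mul mulmxA. Qed.

Lemma inner_mulmxr p q r (A : 'M[R]_(p, q)) (V : 'M[R]_(q, r)) B :
  inner (A *m V) B = inner A (B *m V^T).
Proof. by rewrite -inner_tr trmx_mul inner_mulmxl -inner_tr trmx_mul !trmxK. Qed.

Lemma inner_orthogonal p q (U : 'M[R]_p) (V : 'M[R]_q) (A B : 'M[R]_(p, q)) :
  orthogonal_mx U -> orthogonal_mx V ->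
  inner (U *m A *m V^T) (U *m B *m V^T) = inner A B.
Proof.
move=> UU VV; rewrite inner_mulmxr trmxK -mulmxA VV mulmx1.
by rewrite inner_mulmxl mulmxA UU mul1mx.
Qed.

Lemma enorm_orthogonal p q (U : 'M[R]_p) (V : 'M[R]_q) (A : 'M[R]_(p, q)) :
  orthogonal_mx U -> orthogonal_mx V -> enorm (U *m A *m V^T) = enorm A.
Proof. by move=> UU VV; rewrite /enorm inner_orthogonal. Qed.

Lemma enorm_orthogonalr p q (V : 'M[R]_q) (A : 'M[R]_(p, q)) :
  orthogonal_mx V -> enorm (A *m V) = enorm A.
Proof.
move=> /orthogonal_tr VV; rewrite -(enorm_orthogonal A (orthogonal1 p) VV).
by rewrite mul1mx trmxK.
Qed.

Lemma enorm_mulmx p q r (A : 'M[R]_(p, q)) (B : 'M[R]_(q, r)) :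
  enorm (A *m B) <= enorm A * enorm B.
Proof.
rewrite -(@ler_pXn2r _ 2) ?nnegrE ?mulr_ge0 ?enorm_ge0 //.
rewrite exprMn !sqr_enorm -(inner_tr B) !inner_sum mulr_suml.
apply: ler_sum => i _; rewrite mulr_sumr; apply: ler_sum => j _.
have sq k (x : 'cV[R]_k) : inner x x = \sum_l x l 0 * x l 0 by exact: inner_col.
pose a := (row i A)^T; pose b := col j B.
have -> : (A *m B) i j = inner a b.
  by rewrite mxE inner_col; apply: eq_bigr => k _; rewrite !mxE.
have -> : \sum_k A i k * A i k = enorm a ^+ 2.
  by rewrite sqr_enorm sq; apply: eq_bigr => k _; rewrite !mxE.
have -> : \sum_k B^T j k * B^T j k = enorm b ^+ 2.
  by rewrite sqr_enorm sq; apply: eq_bigr => k _; rewrite !mxE.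
have h1 := cauchy_schwarz a b.
have h2 : - inner a b <= enorm a * enorm b.
  have := cauchy_schwarz ((-1) *: a) b; rewrite innerZl mulN1r.
  by rewrite enormZ normrN1 mul1r.
have p0 := mulr_ge0 (enorm_ge0 a) (enorm_ge0 b).
rewrite -expr2 -exprMn -[leLHS]real_normK ?num_real //.
by rewrite ler_pXn2r ?nnegrE // ler_norml; apply/andP; split; lra.
Qed.

(** A matrix at distance less than one from an orthogonal one is injective,
    since the orthogonal one preserves lengths. *)
Lemma unitmx_near_orthogonal n (T M : 'M[R]_n) :
  orthogonal_mx M -> enorm (T - M) < 1 -> T \in unitmx.
Proof.
move=> MM TM; rewrite -row_free_unit -kermx_eq0.
apply/eqP/row_matrixP => i; rewrite row0.
set v := row i _; have vT : v *m T = 0.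
  by rewrite /v -row_mul mulmx_ker row0.
apply: enorm0_eq0; apply/eqP; rewrite eq_le enorm_ge0 andbT leNgt.
apply/negP => v0.
have : enorm v <= enorm v * enorm (T - M).
  rewrite -[leLHS](enorm_orthogonalr v MM).
  have -> : enorm (v *m M) = enorm (v *m (T - M)).
    by rewrite mulmxBr vT -[in LHS](subr0 (v *m M)) enorm_distC.
  exact: enorm_mulmx.
by rewrite leNgt -[ltRHS]mulr1 ltr_pM2l // TM.
Qed.

End Orthogonal.

(** * Von Neumann's trace inequality for explicit factorizations *)

Section VonNeumann.
Variable R : realType.

Definition nonincr_nonneg n (x : 'cV[R]_n) :=
  (forall i, 0 <= x i 0) /\ (forall i j : 'I_n, (i <= j)%N -> x j 0 <= x i 0).

(** Summation by parts: a nonincreasing nonnegative vector is a nonnegative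
    combination of the indicator vectors of initial segments. *)
Lemma abel_sum_ge0 n (x : 'cV[R]_n) (c : 'I_n -> R) :
  nonincr_nonneg x ->
  (forall p : 'I_n, 0 <= \sum_(i < n | (i <= p)%N) c i) ->
  0 <= \sum_i x i 0 * c i.
Proof.
move=> [x0 xm] c0.
pose xx k := if insub k is Some i then x i 0 else 0.
have xxE (i : 'I_n) : xx i = x i 0 by rewrite /xx valK.
have xxn : xx n = 0 by rewrite /xx insubN // ltnn.
have a0 (p : 'I_n) : 0 <= xx p - xx p.+1.
  rewrite subr_ge0 xxE /xx; case: insubP => [j _ jE|//].
  by apply: xm; rewrite jE.
have xE i : x i 0 = \sum_(p < n | (i <= p)%N) (xx p - xx p.+1).
  have := telescope_sumr xx (ltnW (ltn_ord i)).
  rewrite xxn sub0r xxE => /(congr1 -%R); rewrite opprK => <-.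
  rewrite big_geq_mkord /= -sumrN.
  by apply: eq_bigr => p _; rewrite opprB.
have -> : \sum_i x i 0 * c i =
    \sum_(p < n) (xx p - xx p.+1) * \sum_(i < n | (i <= p)%N) c i.
  under eq_bigr => i _ do rewrite xE mulr_suml big_mkcond.
  rewrite exchange_big /=; apply: eq_bigr => p _.
  by rewrite mulr_sumr [RHS]big_mkcond.
by apply: sumr_ge0 => p _; rewrite mulr_ge0.
Qed.

Lemma substochastic_le n (x y : 'cV[R]_n) (M : 'I_n -> 'I_n -> R) :
  nonincr_nonneg x -> nonincr_nonneg y -> (forall i k, 0 <= M i k) ->
  (forall i, \sum_k M i k <= 1) -> (forall k, \sum_i M i k <= 1) ->
  \sum_i \sum_k x i 0 * y k 0 * M i k <= \sum_i x i 0 * y i 0.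
Proof.
move=> xs ys M0 Mr Mc; rewrite -subr_ge0 -sumrB.
have -> : \sum_i (x i 0 * y i 0 - \sum_k x i 0 * y k 0 * M i k) =
    \sum_i x i 0 * (y i 0 - \sum_k y k 0 * M i k).
  apply: eq_bigr => i _; rewrite mulrBr mulr_sumr; congr (_ - _).
  by apply: eq_bigr => k _; rewrite mulrA.
apply: abel_sum_ge0 => // p.
have -> : \sum_(i < n | (i <= p)%N) (y i 0 - \sum_k y k 0 * M i k) =
    \sum_k y k 0 * ((k <= p)%N%:R - \sum_(i < n | (i <= p)%N) M i k).
  rewrite sumrB exchange_big /= big_mkcond /= -sumrB; apply: eq_bigr => k _.
  by rewrite mulrBr mulr_sumr; case: (_ <= _)%N; rewrite ?mulr1 ?mulr0.
apply: abel_sum_ge0 => // q; have [pq|/ltnW qp] := leqP p q; last first.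
  apply: sumr_ge0 => k kq; rewrite (leq_trans kq qp) subr_ge0.
  apply: le_trans (Mc k); rewrite [leLHS]big_mkcond ler_sum // => i _.
  by case: ifP.
rewrite sumrB subr_ge0 exchange_big /=.
have -> : \sum_(k < n | (k <= q)%N) (k <= p)%N%:R =
    \sum_(k < n | (k <= p)%N) 1 :> R.
  rewrite big_mkcond [RHS]big_mkcond; apply: eq_bigr => k _.
  by have [kp|] := leqP k p; [rewrite (leq_trans kp pq)|case: ifP].
apply: ler_sum => i _; apply: le_trans (Mr i).
by rewrite [leLHS]big_mkcond ler_sum // => k _; case: ifP.
Qed.

Definition rdiag n m (d : 'cV[R]_n) : 'M[R]_(n, m) :=
  \matrix_(i, j) (d i 0 *+ (i == j :> nat)).

Lemma rdiag_mulE n m p (nm : (n <= m)%N) (d : 'cV[R]_n) (A : 'M[R]_(m, p)) i l :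
  (rdiag m d *m A) i l = d i 0 * A (widen_ord nm i) l.
Proof.
rewrite mxE (bigD1 (widen_ord nm i)) //= mxE eqxx mulr1n big1 ?addr0 // => j.
rewrite -val_eqE /= mxE eq_sym => /negbTE ->.
by rewrite mul0r.
Qed.

Lemma inner_rdiag n m (nm : (n <= m)%N) (d : 'cV[R]_n) (A : 'M[R]_(n, m)) :
  inner (rdiag m d) A = \sum_i d i 0 * A i (widen_ord nm i).
Proof.
rewrite inner_sum; apply: eq_bigr => i _.
rewrite (bigD1 (widen_ord nm i)) //= mxE eqxx mulr1n big1 ?addr0 // => j.
rewrite -val_eqE /= mxE eq_sym => /negbTE ->.
by rewrite mul0r.
Qed.

Lemma inner_rdiag2 n m (nm : (n <= m)%N) (d e : 'cV[R]_n) :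
  inner (rdiag m d) (rdiag m e) = inner d e.
Proof.
rewrite (inner_rdiag nm) inner_col; apply: eq_bigr => i _.
by rewrite !mxE eqxx mulr1n.
Qed.

Lemma rdiagD n m (d e : 'cV[R]_n) : rdiag m (d + e) = rdiag m d + rdiag m e.
Proof. by apply/matrixP => i j; rewrite !mxE mulrnDl. Qed.

Lemma rdiagB n m (d e : 'cV[R]_n) : rdiag m (d - e) = rdiag m d - rdiag m e.
Proof. by apply/matrixP => i j; rewrite !mxE mulrnBl. Qed.

Lemma enorm_rdiag n m (nm : (n <= m)%N) (d : 'cV[R]_n) :
  enorm (rdiag m d) = enorm d.
Proof. by rewrite /enorm inner_rdiag2. Qed.

Lemma sum_row_sqr_orthogonal n (U : 'M[R]_n) i :
  orthogonal_mx U -> \sum_j U i j ^+ 2 = 1.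
Proof.
move=> /orthogonal_mxT/matrixP/(_ i i); rewrite !mxE eqxx mulr1n => <-.
by apply: eq_bigr => j _; rewrite mxE.
Qed.

Lemma sum_row_sqr_widen n m (nm : (n <= m)%N) (V : 'M[R]_m) i :
  orthogonal_mx V -> \sum_(k < n) V i (widen_ord nm k) ^+ 2 <= 1.
Proof.
move=> /(sum_row_sqr_orthogonal i) <-.
rewrite -(@big_ord_narrow _ _ _ n m (fun j => V i j ^+ 2) nm) big_mkcond.
by apply: ler_sum => j _; case: ifP => // _; rewrite sqr_ge0.
Qed.

(** In the coordinates of the first factorization the inner product is a bilinear
    form in the two diagonals whose matrix has entries p * q, with p and q
    entries of two orthogonal matrices.  Bounding p * q by (p^2 + q^2) / 2 makes
    this matrix doubly substochastic. *)
Lemma von_neumann_rdiag n m (nm : (n <= m)%N) (x y : 'cV[R]_n)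
    (U U' : 'M[R]_n) (V V' : 'M[R]_m) :
  orthogonal_mx U -> orthogonal_mx U' -> orthogonal_mx V -> orthogonal_mx V' ->
  nonincr_nonneg x -> nonincr_nonneg y ->
  inner (U *m rdiag m x *m V^T) (U' *m rdiag m y *m V'^T) <= inner x y.
Proof.
move=> UU UU' VV VV' xs ys.
pose P := U^T *m U'; pose Q := V'^T *m V.
have PP : orthogonal_mx P by apply: orthogonalM => //; exact: orthogonal_tr.
have QQ : orthogonal_mx Q by apply: orthogonalM => //; exact: orthogonal_tr.
have -> : inner (U *m rdiag m x *m V^T) (U' *m rdiag m y *m V'^T) =
    inner (rdiag m x) (P *m (rdiag m y *m Q)).
  by rewrite inner_mulmxr trmxK inner_mulmxl /P /Q !mulmxA.
clearbody P Q; pose w := widen_ord nm.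
pose M i k := (P i k ^+ 2 + Q (w k) (w i) ^+ 2) / 2.
rewrite (inner_rdiag nm) inner_col.
apply: (@le_trans _ _ (\sum_i \sum_k x i 0 * y k 0 * M i k)).
  apply: ler_sum => i _; rewrite mxE mulr_sumr; apply: ler_sum => k _.
  rewrite (rdiag_mulE nm) -/w -mulrA ler_wpM2l ?(xs.1) // mulrCA.
  rewrite ler_wpM2l ?(ys.1) // /M.
  by have := sqr_ge0 (P i k - Q (w k) (w i)); lra.
have half (a b : R) : a <= 1 -> b <= 1 -> (a + b) / 2 <= 1 by lra.
apply: substochastic_le => // [i k|i|k].
- by rewrite /M divr_ge0 // addr_ge0 ?sqr_ge0.
- rewrite /M -mulr_suml big_split /= half ?sum_row_sqr_orthogonal //.
  have /(sum_row_sqr_widen nm (w i)) := orthogonal_tr QQ.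
  by apply: le_trans; apply: ler_sum => j _; rewrite mxE.
- rewrite /M -mulr_suml big_split /= half ?sum_row_sqr_widen //.
  have /(sum_row_sqr_orthogonal k) := orthogonal_tr PP.
  by move=> <-; apply: ler_sum => j _; rewrite mxE.
Qed.

End VonNeumann.

(** * Singular value and spectral decompositions *)

Section Decomposition.
Variable R : realType.

Lemma char_poly_similar n (U A : 'M[R]_n) :
  orthogonal_mx U -> char_poly (U *m A *m U^T) = char_poly A.
Proof.
move=> /orthogonal_mxT UU; rewrite /char_poly /char_poly_mx !map_mxM /=.
set Q := map_mx _ U; set Q' := map_mx _ U^T.
have QQ' : Q *m Q' = 1%:M by rewrite -map_mxM UU map_mx1.
have XE : 'X%:M = Q *m 'X%:M *m Q' :> 'M[{poly R}]_n.
  by rewrite scalar_mxC -mulmxA QQ' mulmx1.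
rewrite [in LHS]XE -mulmxBl -mulmxBr !det_mulmx [LHS]mulrC mulrA.
by rewrite -det_mulmx (mulmx1C QQ') det1 mul1r.
Qed.

Lemma char_poly_block p q (A : 'M[R]_p) (B : 'M[R]_q) :
  char_poly (block_mx A 0 0 B) = char_poly A * char_poly B.
Proof.
rewrite /char_poly /char_poly_mx map_block_mx !map_mx0 scalar_mx_block.
by rewrite opp_block_mx add_block_mx !oppr0 !addr0 det_ublock.
Qed.

Lemma char_poly_scalar1 (a : R) : char_poly (a%:M : 'M[R]_1) = 'X - a%:P.
Proof. by rewrite /char_poly /char_poly_mx map_scalar_mx det_mx11 !mxE. Qed.

(** Unless u is the first basis vector, H is the reflection exchanging the two. *)
Lemma orthogonal_first_row n (u : 'rV[R]_n.+1) :
  enorm u = 1 -> exists2 H : 'M[R]_n.+1, orthogonal_mx H & delta_mx 0 0 *m H = u.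
Proof.
move=> u1; set e : 'rV[R]_n.+1 := delta_mx 0 0.
have ee : enorm e = 1.
  rewrite /enorm inner_sum big_ord1 (bigD1 0) //= big1 ?addr0 => [|j j0].
    by rewrite mxE !eqxx mulr1 sqrtr1.
  by rewrite mxE (negPf j0) andbF mul0r.
have [<-|ue] := eqVneq e u.
  by exists 1%:M; rewrite ?mulmx1 //; exact: orthogonal1.
pose a : 'rV[R]_n.+1 := u - e.
have a0 : a != 0 by rewrite subr_eq0 eq_sym.
have aa : inner a a != 0 by rewrite gt_eqF // inner_gt0.
have aE (x : 'rV[R]_n.+1) : x *m a^T = (inner x a)%:M.
  rewrite [LHS]mx11_scalar; congr _%:M; rewrite inner_sum big_ord1 mxE.
  by apply: eq_bigr => j _; rewrite mxE.
have [c cE] : exists c, c = 2 / inner a a by exists (2 / inner a a).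
exists (1%:M - c *: (a^T *m a)).
  rewrite /orthogonal_mx.
  have -> : (1%:M - c *: (a^T *m a))^T = 1%:M - c *: (a^T *m a).
    by rewrite [LHS]linearB [in LHS]linearZ /= trmx1 trmx_mul trmxK.
  have BB : a^T *m a *m (a^T *m a) = inner a a *: (a^T *m a).
    by rewrite -mulmxA (mulmxA a a^T) aE mul_scalar_mx -scalemxAr.
  rewrite mulmxBr mulmx1 mulmxBl mul1mx -scalemxAl -scalemxAr BB.
  set B := a^T *m a; rewrite (scalerA c (inner a a) B).
  have -> : c * inner a a = 2 by rewrite cE; field.
  rewrite scaler_nat mulr2n scalerDr opprB.
  by rewrite addrK subrK.
rewrite mulmxBr mulmx1 -scalemxAr mulmxA aE mul_scalar_mx scalerA.
have -> : c * inner e a = -1.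
  have h : inner a a = - 2 * inner e a.
    have := sqr_enormB u e; rewrite -/a u1 ee sqr_enorm => ->.
    by rewrite /a innerBr -(sqr_enorm e) ee (innerC e u); lra.
  have ea : inner e a != 0 by apply: contra aa => /eqP ea; rewrite h ea mulr0.
  by rewrite cE h; field.
by rewrite scaleN1r opprK /a addrC subrK.
Qed.

(** One step of deflation: in orthonormal bases starting with a pair of singular
    vectors, the matrix splits off the singular value as a block. *)
Lemma deflation n m (X : 'M[R]_(n.+1, m.+1)) (s : R)
    (u : 'rV[R]_n.+1) (v : 'rV[R]_m.+1) (H : 'M[R]_n.+1)
    (K : 'M[R]_m.+1) :
  orthogonal_mx H -> orthogonal_mx K ->
  delta_mx 0 0 *m H = u -> delta_mx 0 0 *m K = v ->
  u *m X = s *: v -> X *m v^T = s *: u^T ->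
  exists X' : 'M[R]_(n, m),
    X = H^T *m (block_mx s%:M 0 0 X' : 'M[R]_(1 + n, 1 + m)) *m K.
Proof.
move=> HH KK Hu Kv uX Xv.
have [Y YE] : exists Y, Y = H *m X *m K^T by exists (H *m X *m K^T).
pose Yb : 'M[R]_(1 + n, 1 + m) := Y; exists (drsubmx Yb).
have Yr : delta_mx 0 0 *m Y = s *: delta_mx 0 0 :> 'rV[R]_m.+1.
  rewrite YE !mulmxA Hu uX -scalemxAl -Kv -mulmxA (orthogonal_mxT KK).
  by rewrite mulmx1.
have Yc : Y *m (delta_mx 0 0)^T = s *: (delta_mx 0 0)^T :> 'cV[R]_n.+1.
  have Kv' : K^T *m (delta_mx 0 0)^T = v^T by rewrite -Kv trmx_mul.
  rewrite YE -mulmxA [K^T *m _]Kv' -mulmxA Xv -scalemxAr -Hu trmx_mul mulmxA.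
  by rewrite (orthogonal_mxT HH) mul1mx.
have row0E j : Y 0 j = s *+ (0 == j).
  have := congr1 (fun A : 'rV[R]_m.+1 => A 0 j) Yr.
  by rewrite -rowE !mxE eqxx /= eq_sym mulr_natr.
have col0E i : Y i 0 = s *+ (0 == i).
  have := congr1 (fun A : 'cV[R]_n.+1 => A i 0) Yc.
  by rewrite trmx_delta -colE !mxE eqxx /= eq_sym mulr_natr.
have ln : lshift n 0 = 0 :> 'I_(1 + n) by exact/val_inj.
have lm : lshift m 0 = 0 :> 'I_(1 + m) by exact/val_inj.
have -> : block_mx s%:M 0 0 (drsubmx Yb) = Yb.
  rewrite -[RHS]submxK; congr (block_mx _ _ _ _).
  - by apply/matrixP => i j; rewrite !ord1 !mxE ln lm; exact/esym/row0E.
  - by apply/matrixP => i j; rewrite !ord1 !mxE ln; exact/esym/row0E.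
  - by apply/matrixP => i j; rewrite !ord1 !mxE lm; exact/esym/col0E.
by rewrite /Yb YE !mulmxA HH mul1mx -mulmxA KK mulmx1.
Qed.

Lemma rdiag_block n m (a : R) (d : 'cV[R]_n) :
  rdiag (1 + m) (col_mx a%:M d : 'cV[R]_(1 + n)) =
    block_mx a%:M 0 0 (rdiag m d).
Proof.
apply/matrixP => i j; rewrite mxE.
case: (split_ordP i) => i' ->; case: (split_ordP j) => j' ->.
- by rewrite [RHS]block_mxEul col_mxEu !ord1.
- by rewrite [RHS]block_mxEur !mxE !ord1.
- by rewrite [RHS]block_mxEdl !mxE !ord1.
- by rewrite [RHS]block_mxEdr col_mxEd mxE eqn_add2l.
Qed.

Lemma col_mx_first n (d : 'cV[R]_n.+1) :
  d = (col_mx (d 0 0)%:M (\col_i d (lift 0 i) 0) : 'cV[R]_(1 + n)).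
Proof.
apply/colP => i; case: (split_ordP (i : 'I_(1 + n))) => i' ->.
  rewrite [RHS]col_mxEu ord1 mxE eqxx mulr1n; congr (d _ _); exact/val_inj.
by rewrite [RHS]col_mxEd mxE; congr (d _ _); exact/val_inj.
Qed.

Lemma orthogonal_block p q (U : 'M[R]_p) (V : 'M[R]_q) :
  orthogonal_mx U -> orthogonal_mx V -> orthogonal_mx (block_mx U 0 0 V).
Proof.
rewrite /orthogonal_mx => UU VV.
rewrite tr_block_mx !trmx0 mulmx_block !mul0mx !mulmx0 !addr0 !add0r UU VV.
by rewrite -scalar_mx_block.
Qed.

Lemma rdiag_gram n m (nm : (n <= m)%N) (d : 'cV[R]_n) :
  rdiag m d *m (rdiag m d)^T = rdiag n (\col_i (d i 0 ^+ 2)).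
Proof.
apply/matrixP => i j; rewrite (rdiag_mulE nm) !mxE /=.
by have [/val_inj ->|ij] := eqVneq (i : nat) j; rewrite ?mulr0n ?mulr0 // eqxx.
Qed.

Lemma char_poly_rdiag n (d : 'cV[R]_n) :
  char_poly (rdiag n d) = \prod_(i < n) ('X - (d i 0)%:P).
Proof.
have -> : rdiag n d = diag_mx d^T.
  by apply/matrixP => i j; rewrite !mxE.
rewrite char_poly_trig ?diag_mx_is_trig //; apply: eq_bigr => i _.
by rewrite !mxE eqxx mulr1n.
Qed.

Lemma char_poly_factored n m (nm : (n <= m)%N) (U : 'M[R]_n) (V : 'M[R]_m)
    (d : 'cV[R]_n) :
  orthogonal_mx U -> orthogonal_mx V ->
  char_poly ((U *m rdiag m d *m V^T) *m (U *m rdiag m d *m V^T)^T) =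
    \prod_(i < n) ('X - (d i 0 ^+ 2)%:P).
Proof.
move=> UU VV; rewrite !trmx_mul trmxK -!mulmxA (mulmxA V^T) VV mul1mx.
rewrite (mulmxA (rdiag _ _)) rdiag_gram // mulmxA char_poly_similar //.
by rewrite char_poly_rdiag; apply: eq_bigr => i _; rewrite mxE.
Qed.

Lemma eigenvector_first n (A : 'M[R]_n.+1) (d : 'cV[R]_n.+1) :
  char_poly A = \prod_(i < n.+1) ('X - (d i 0)%:P) ->
  exists2 u : 'rV[R]_n.+1, u != 0 & u *m A = d 0 0 *: u.
Proof.
move=> AE; have : eigenvalue A (d 0 0).
  by rewrite eigenvalue_root_char AE big_ord_recl rootM root_XsubC eqxx.
by move=> /eigenvalueP[v vA v0]; exists v.
Qed.

Lemma enorm_normalize n (u : 'rV[R]_n) :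
  u != 0 -> enorm ((enorm u)^-1 *: u) = 1.
Proof.
move=> u0; have un : enorm u != 0 by apply: contra u0 => /eqP /enorm0_eq0 ->.
by rewrite enormZ normfV ger0_norm ?enorm_ge0 // mulVf.
Qed.

Lemma singular_pair n m (nm : (n <= m)%N) (X : 'M[R]_(n.+1, m.+1)) s
    (u0 : 'rV[R]_n.+1) :
  u0 != 0 -> u0 *m (X *m X^T) = s ^+ 2 *: u0 ->
  exists (u : 'rV[R]_n.+1) (v : 'rV[R]_m.+1),
    [/\ enorm u = 1, enorm v = 1, u *m X = s *: v & X *m v^T = s *: u^T].
Proof.
move=> u00 u0E; pose u := (enorm u0)^-1 *: u0.
have u1 : enorm u = 1 by exact: enorm_normalize.
have uE : u *m (X *m X^T) = s ^+ 2 *: u.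
  by rewrite /u -scalemxAl u0E !scalerA mulrC.
have uX2 : enorm (u *m X) ^+ 2 = s ^+ 2.
  rewrite sqr_enorm inner_mulmxr -mulmxA uE innerC innerZl -sqr_enorm u1.
  by rewrite expr1n mulr1.
exists u; have [s0|s0] := eqVneq s 0.
  have uX : u *m X = 0.
    apply: enorm0_eq0; apply/eqP.
    by rewrite -sqrf_eq0 uX2 s0 expr0n.
  (* When s vanishes, v is taken in the kernel of X, which is nontrivial because the
     rank of X is below n.+1 <= m.+1. *)
  have rX : (\rank X < m.+1)%N.
    apply: (@leq_trans n.+1) => //; rewrite ltn_neqAle rank_leq_row andbT.
    apply/negP => /row_free_inj /(_ u 0) /=; rewrite uX mul0mx => /(_ erefl) u00'.
    by move: u1; rewrite u00' enorm0 => /eqP; rewrite eq_sym oner_eq0.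
  have : kermx X^T != 0.
    by rewrite kermx_eq0 /row_free mxrank_tr neq_ltn rX.
  move=> /rowV0Pn[v /sub_kermxP vX v0].
  exists ((enorm v)^-1 *: v); split=> //; first exact: enorm_normalize.
    by rewrite uX s0 scale0r.
  rewrite s0 scale0r; apply: trmx_inj.
  by rewrite trmx_mul trmxK -scalemxAl vX scaler0 trmx0.
exists (s^-1 *: (u *m X)); split=> //.
- rewrite enormZ -[enorm _]ger0_norm ?enorm_ge0 // -(sqrtr_sqr (enorm _)) uX2.
  by rewrite sqrtr_sqr normfV mulVf // normr_eq0.
- by rewrite scalerA divff // scale1r.
- apply: trmx_inj; rewrite trmx_mul trmxK -scalemxAl -mulmxA uE scalerA.
  by rewrite expr2 mulrA mulVf // mul1r [RHS]linearZ /= trmxK.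
Qed.

Lemma prod_XsubC_cancel n (d : 'cV[R]_n.+1) (p : {poly R}) :
  ('X - (d 0 0 ^+ 2)%:P) * p = \prod_(i < n.+1) ('X - (d i 0 ^+ 2)%:P) ->
  p = \prod_(i < n) ('X - ((\col_k d (lift 0 k) 0 : 'cV[R]_n) i 0 ^+ 2)%:P).
Proof.
rewrite big_ord_recl => /mulfI; rewrite polyXsubC_eq0 => /(_ isT) ->.
by apply: eq_bigr => i _; rewrite mxE.
Qed.

Lemma char_poly_deflated n m (H : 'M[R]_n.+1) (K : 'M[R]_m.+1) (s : R)
    (X' : 'M[R]_(n, m)) (X : 'M[R]_(n.+1, m.+1)) :
  orthogonal_mx H -> orthogonal_mx K ->
  X = H^T *m (block_mx s%:M 0 0 X' : 'M[R]_(1 + n, 1 + m)) *m K ->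
  char_poly (X *m X^T) = ('X - (s ^+ 2)%:P) * char_poly (X' *m X'^T).
Proof.
move=> HH KK ->; set Y := block_mx _ _ _ _.
have -> : H^T *m Y *m K *m (H^T *m Y *m K)^T = H^T *m (Y *m Y^T) *m H^T^T.
  rewrite !trmx_mul -!mulmxA (mulmxA K K^T) orthogonal_mxT // mul1mx.
  by rewrite !mulmxA.
rewrite char_poly_similar; last exact: orthogonal_tr.
have -> : Y *m Y^T =
    (block_mx (s ^+ 2)%:M 0 0 (X' *m X'^T) : 'M[R]_(1 + n)).
  rewrite [Y^T](@tr_block_mx _ 1 n 1 m) [LHS](@mulmx_block _ 1 n 1 m 1 n).
  rewrite !trmx0 !mulmx0 !mul0mx !addr0 add0r tr_scalar_mx -scalar_mxM.
  by rewrite expr2.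
by rewrite (@char_poly_block 1 n) char_poly_scalar1.
Qed.

Lemma block_factorization n m (s e : R) (d : 'cV[R]_n) (U : 'M[R]_n)
    (V : 'M[R]_m) :
  block_mx (s * e)%:M 0 0 (U *m rdiag m d *m V^T) =
    block_mx 1%:M 0 0 U *m rdiag (1 + m) (col_mx s%:M d : 'cV[R]_(1 + n)) *m
    (block_mx e%:M 0 0 V)^T.
Proof.
rewrite rdiag_block tr_block_mx !mulmx_block !trmx0.
rewrite !mulmx0 !mul0mx !addr0 !add0r !mul1mx tr_scalar_mx.
by rewrite !mul0mx -scalar_mxM.
Qed.

(** Any list of numbers whose squares are the eigenvalues of the Gram matrix can
    be put on the diagonal, in any order and with any signs. *)
Lemma svd n m (X : 'M[R]_(n, m)) (s : 'cV[R]_n) :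
  (n <= m)%N ->
  char_poly (X *m X^T) = \prod_(i < n) ('X - (s i 0 ^+ 2)%:P) ->
  exists (U : 'M[R]_n) (V : 'M[R]_m),
    [/\ orthogonal_mx U, orthogonal_mx V & X = U *m rdiag m s *m V^T].
Proof.
elim: n m X s => [|n IH] [|m] X s // nm XE.
- exists 1%:M, 1%:M; split; try exact: orthogonal1.
  by rewrite [LHS]flatmx0 [RHS]flatmx0.
- exists 1%:M, 1%:M; split; try exact: orthogonal1.
  by rewrite [LHS]flatmx0 [RHS]flatmx0.
have nm' : (n <= m)%N by [].
have [u0 u00 u0E] : exists2 u : 'rV[R]_n.+1, u != 0 &
    u *m (X *m X^T) = s 0 0 ^+ 2 *: u.
  have := @eigenvector_first _ (X *m X^T) (\col_i (s i 0 ^+ 2)).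
  rewrite mxE; apply; rewrite XE; by apply: eq_bigr => i _; rewrite mxE.
have [u [v [u1 v1 uX Xv]]] := singular_pair nm' u00 u0E.
have [H HH Hu] := orthogonal_first_row u1.
have [K KK Kv] := orthogonal_first_row v1.
have [X' X'E] := deflation HH KK Hu Kv uX Xv.
have X'char := char_poly_deflated HH KK X'E.
have [U' [V' [UU VV X'svd]]] :=
  IH m X' _ nm' (prod_XsubC_cancel (etrans (esym X'char) XE)).
exists (H^T *m (block_mx 1%:M 0 0 U' : 'M[R]_(1 + n))).
exists (K^T *m (block_mx 1%:M 0 0 V' : 'M[R]_(1 + m))); split.
- apply: orthogonalM; first exact: orthogonal_tr.
  by apply: (@orthogonal_block 1 n) => //; exact: orthogonal1.
- apply: orthogonalM; first exact: orthogonal_tr.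
  by apply: (@orthogonal_block 1 m) => //; exact: orthogonal1.
rewrite [LHS]X'E X'svd -[s 0 0]mulr1 block_factorization -col_mx_first.
by rewrite trmx_mul trmxK !mulmxA.
Qed.

(** A symmetric matrix has the singular value decomposition with V equal to U up
    to the signs of the eigenvalues: if A^2 - s^2 = (A - s) (A + s) is singular,
    then s or - s is an eigenvalue of A. *)
Lemma symmetric_svd n (A : 'M[R]_n) (s : 'cV[R]_n) :
  A^T = A -> char_poly (A *m A^T) = \prod_(i < n) ('X - (s i 0 ^+ 2)%:P) ->
  exists (U : 'M[R]_n) (e : 'cV[R]_n),
    [/\ orthogonal_mx U, forall i, e i 0 ^+ 2 = 1 &
      A = U *m rdiag n s *m (U *m rdiag n e)^T].
Proof.
elim: n A s => [|n IH] A s AT AE.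
  exists 1%:M, 0; split; [exact: orthogonal1|by case|].
  by rewrite [LHS]flatmx0 [RHS]flatmx0.
have [u0 u00 u0E] : exists2 u : 'rV[R]_n.+1, u != 0 &
    u *m (A *m A) = s 0 0 ^+ 2 *: u.
  have := @eigenvector_first _ (A *m A^T) (\col_i (s i 0 ^+ 2)).
  rewrite mxE AT; apply; rewrite -{2}AT AE.
  by apply: eq_bigr => i _; rewrite mxE.
have [e0 [v [e01 v0 vA]]] : exists (e0 : R) (v : 'rV[R]_n.+1),
    [/\ e0 ^+ 2 = 1, v != 0 & v *m A = (s 0 0 * e0) *: v].
  have [w0|w0] := eqVneq (u0 *m A + s 0 0 *: u0) 0.
    exists (-1), u0; split; rewrite ?sqrrN ?expr1n //.
    by rewrite mulrN1 scaleNr; apply/eqP; rewrite -subr_eq0 opprK w0.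
  exists 1, (u0 *m A + s 0 0 *: u0); split; rewrite ?expr1n // mulr1.
  rewrite mulmxDl -mulmxA u0E -scalemxAl scalerDr scalerA expr2.
  by rewrite addrC.
pose u := (enorm v)^-1 *: v.
have u1 : enorm u = 1 by exact: enorm_normalize.
have uA : u *m A = (s 0 0 * e0) *: u by rewrite /u -scalemxAl vA !scalerA mulrC.
have Au : A *m u^T = (s 0 0 * e0) *: u^T.
  by apply: trmx_inj; rewrite trmx_mul trmxK AT uA [RHS]linearZ /= trmxK.
have [H HH Hu] := orthogonal_first_row u1.
have [A' A'E] := deflation HH HH Hu Hu uA Au.
have A'T : A'^T = A'.
  have : H *m A *m H^T = (block_mx (s 0 0 * e0)%:M 0 0 A' : 'M[R]_(1 + n)).
    by rewrite A'E !mulmxA orthogonal_mxT // mul1mx -mulmxA orthogonal_mxT // mulmx1.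
  move=> /[dup] BE /(congr1 trmx); rewrite !trmx_mul trmxK AT mulmxA BE.
  rewrite [RHS](@tr_block_mx _ 1 n 1 n) => blockE.
  by have [_ _ _ <-] := @eq_block_mx _ 1 n 1 n _ _ _ _ _ _ _ _ blockE.
have A'char := char_poly_deflated HH HH A'E.
rewrite exprMn e01 mulr1 AE in A'char.
have [U' [e [UU e1 A'svd]]] := IH A' _ A'T (prod_XsubC_cancel (esym A'char)).
have ee1 (i : 'I_(1 + n)) : (col_mx e0%:M e : 'cV[R]_(1 + n)) i 0 ^+ 2 = 1.
  case: (split_ordP i) => i' ->; last by rewrite col_mxEd.
  by rewrite col_mxEu ord1 mxE eqxx mulr1n.
exists (H^T *m (block_mx 1%:M 0 0 U' : 'M[R]_(1 + n))).
exists (col_mx e0%:M e : 'cV[R]_(1 + n)); split.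
- apply: orthogonalM; first exact: orthogonal_tr.
  by apply: (@orthogonal_block 1 n) => //; exact: orthogonal1.
- exact: ee1.
have BD : block_mx 1%:M 0 0 U' *m rdiag (1 + n) (col_mx e0%:M e) =
    block_mx e0%:M 0 0 (U' *m rdiag n e).
  rewrite rdiag_block mulmx_block.
  by rewrite !mulmx0 !mul0mx !addr0 !add0r mul1mx.
rewrite [LHS]A'E A'svd block_factorization -col_mx_first -BD.
by rewrite !trmx_mul trmxK !mulmxA.
Qed.

End Decomposition.

(** * Singular values *)

Section SingularValues.
Variables (R : realType) (n m : nat).
Hypothesis nm : (n <= m)%N.
Implicit Types (X Y W : 'M[R]_(n, m)) (U : 'M[R]_n) (V : 'M[R]_m).
Implicit Types (x y w : 'cV[R]_n) (g : 'cV[R]_n -> \bar R).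

Lemma singular_values_nonincr X : nonincr_nonneg (singular_values X).
Proof. by have [] := singular_valuesP X. Qed.

Lemma singular_values_svd X :
  exists U V, [/\ orthogonal_mx U, orthogonal_mx V &
    X = U *m rdiag m (singular_values X) *m V^T].
Proof. by have [_ _] := singular_valuesP X; exact: svd. Qed.

Lemma inner_factored U V x y : orthogonal_mx U -> orthogonal_mx V ->
  inner (U *m rdiag m x *m V^T) (U *m rdiag m y *m V^T) = inner x y.
Proof. by move=> UU VV; rewrite inner_orthogonal // inner_rdiag2. Qed.

Lemma enorm_factored U V x : orthogonal_mx U -> orthogonal_mx V ->
  enorm (U *m rdiag m x *m V^T) = enorm x.
Proof. by move=> UU VV; rewrite enorm_orthogonal // enorm_rdiag. Qed.

Lemma enorm_factoredB U V x y : orthogonal_mx U -> orthogonal_mx V ->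
  enorm (U *m rdiag m x *m V^T - U *m rdiag m y *m V^T) = enorm (x - y).
Proof.
by move=> UU VV; rewrite -mulmxBl -mulmxBr -rdiagB enorm_factored.
Qed.

Lemma enorm_singular_values X : enorm (singular_values X) = enorm X.
Proof.
have [U [V [UU VV XE]]] := singular_values_svd X.
by rewrite [in RHS]XE enorm_factored.
Qed.

Lemma von_neumann_factored U V w Y :
  orthogonal_mx U -> orthogonal_mx V -> nonincr_nonneg w ->
  inner (U *m rdiag m w *m V^T) Y <= inner w (singular_values Y).
Proof.
move=> UU VV ws; have [U' [V' [UU' VV' YE]]] := singular_values_svd Y.
rewrite {1}YE; apply: von_neumann_rdiag => //.
exact: singular_values_nonincr.
Qed.

Lemma von_neumann X Y :
  inner X Y <= inner (singular_values X) (singular_values Y).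
Proof.
have [U [V [UU VV XE]]] := singular_values_svd X.
by rewrite {1}XE; apply: von_neumann_factored => //; exact: singular_values_nonincr.
Qed.

Lemma singular_values_lipschitz X Y :
  enorm (singular_values X - singular_values Y) <= enorm (X - Y).
Proof.
rewrite -(@ler_pXn2r _ 2) ?nnegrE ?enorm_ge0 // !sqr_enormB.
by rewrite !enorm_singular_values; have := von_neumann X Y; lra.
Qed.

(** Equality in von Neumann's inequality forces a common decomposition.  It makes
    the singular values of the sum Z = X + W the sum of those of X and W, so that
    <X, Z> = <X, U D(a) V^T> + <X, U D(b) V^T> attains the upper bound
    <a, a> + <a, b>; each summand attains its own bound, and the first equality
    means that X is U D(a) V^T. *)
Lemma simultaneous_svd X W U V :
  orthogonal_mx U -> orthogonal_mx V ->
  inner X W = inner (singular_values X) (singular_values W) ->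
  X + W = U *m rdiag m (singular_values (X + W)) *m V^T ->
  X = U *m rdiag m (singular_values X) *m V^T /\
  W = U *m rdiag m (singular_values W) *m V^T.
Proof.
move=> UU VV XW ZE; set z := singular_values (X + W) in ZE.
set a := singular_values X in XW *; set b := singular_values W in XW *.
have Xa : enorm X = enorm a by rewrite enorm_singular_values.
have Wb : enorm W = enorm b by rewrite enorm_singular_values.
have Zz : enorm (X + W) = enorm z by rewrite enorm_singular_values.
have XZ : inner X (X + W) <= inner a z by exact: von_neumann.
have WZ : inner W (X + W) <= inner b z by exact: von_neumann.
have Xb : inner (U *m rdiag m b *m V^T) X <= inner b a.
  by apply: von_neumann_factored => //; exact: singular_values_nonincr.
clearbody a b z.
have Znorm : enorm (X + W) ^+ 2 = enorm (a + b) ^+ 2.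
  by rewrite !sqr_enormD Xa Wb XW.
have zE : z = a + b.
  apply/eqP; rewrite -subr_eq0; apply/eqP/enorm0_eq0/eqP.
  rewrite -sqrf_eq0 eq_le sqr_ge0 andbT sqr_enormB -Zz Znorm innerC.
  move: (lerD XZ WZ); rewrite -!innerDl -sqr_enorm Znorm.
  by clear; lra.
have XE : X = U *m rdiag m a *m V^T.
  apply/eqP; rewrite -subr_eq0; apply/eqP/enorm0_eq0/eqP.
  rewrite -sqrf_eq0 eq_le sqr_ge0 andbT sqr_enormB enorm_factored // Xa.
  have : enorm a ^+ 2 + inner a b =
      inner X (U *m rdiag m a *m V^T) + inner X (U *m rdiag m b *m V^T).
    rewrite -innerDr -mulmxDl -mulmxDr -rdiagD -zE -ZE innerDr -sqr_enorm.
    by rewrite Xa XW.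
  by move: Xb; rewrite (innerC b) (innerC _ X); clear; lra.
split; first exact: XE.
by apply: (addrI X); rewrite [LHS]ZE zE rdiagD mulmxDr mulmxDl {1}XE.
Qed.

Lemma signed_perm_of_sqr x y (p : {perm 'I_n}) :
  (forall i, x i 0 ^+ 2 = y (p i) 0 ^+ 2) ->
  exists2 Q : 'M[R]_n, signed_perm_mx Q & x = Q *m y.
Proof.
move=> xy; pose e i : R := if x i 0 == y (p i) 0 then 1 else -1.
have e0 i : e i != 0 by rewrite /e; case: ifP; rewrite ?oppr_eq0 oner_eq0.
have Q0 i j : (if j == p i then e i else 0) != 0 -> j = p i.
  by case: (j =P p i) => // _; rewrite eqxx.
exists (\matrix_(i, j) (if j == p i then e i else 0)).
  split=> [i|j|i j].
  - exists (p i); split=> [|j]; rewrite mxE; first by rewrite eqxx.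
    by move=> /Q0.
  - exists (p^-1%g j); split=> [|i]; rewrite mxE; first by rewrite permKV eqxx.
    by move=> /Q0 ->; rewrite permK.
  - rewrite mxE => /[dup] /Q0 ->; rewrite eqxx /e.
    by case: ifP; [left|right].
apply/colP => i; rewrite mxE (bigD1 (p i)) //= big1 ?addr0 => [|j].
  rewrite mxE eqxx /e; case: eqP => [->|/eqP ne]; first by rewrite mul1r.
  have /eqP := xy i; rewrite eqf_sqr (negbTE ne) /= => /eqP ->.
  by rewrite mulN1r.
by rewrite mxE => /negbTE ->; rewrite mul0r.
Qed.

Lemma spectral_fun_factored g U V y : absolutely_symmetric g ->
  orthogonal_mx U -> orthogonal_mx V ->
  g (singular_values (U *m rdiag m y *m V^T)) = g y.
Proof.
move=> gs UU VV; set t := singular_values _.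
have [_ _] := singular_valuesP (U *m rdiag m y *m V^T); rewrite -/t.
rewrite char_poly_factored // => tE.
pose sq x := [tuple x i 0 ^+ 2 | i < n].
have prodE x : \prod_(i < n) ('X - (x i 0 ^+ 2)%:P) =
    \prod_(a <- sq x) ('X - a%:P) :> {poly R}.
  by rewrite big_map -big_enum.
have /tuple_permP[p pE] : perm_eq (sq t) (sq y).
  by apply: prod_XsubC_eq; rewrite -!prodE.
have [|Q Qs ->] := @signed_perm_of_sqr t y p; last by rewrite -gs.
move=> i; have := congr1 (fun s => nth 0 s i) pE.
by rewrite -!tnth_nth !tnth_mktuple.
Qed.

(** Testing the subgradient inequality only on the matrices diagonal in the bases
    of W is enough; testing it at y = singular_values X gives the equality case of
    von Neumann's inequality. *)
Lemma subgradient_singular_values g X W U V :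
  proper_fun g -> absolutely_symmetric g ->
  orthogonal_mx U -> orthogonal_mx V ->
  W = U *m rdiag m (singular_values W) *m V^T ->
  (forall y, let Y := U *m rdiag m y *m V^T in
    (g (singular_values X) + (inner W (Y - X))%:E <= g (singular_values Y))%E) ->
  subdifferential g (singular_values X) (singular_values W) /\
  inner X W = inner (singular_values X) (singular_values W).
Proof.
move=> [gN [y0 gy0]] gs UU VV WE h.
have {}h y : (g (singular_values X) +
    (inner (singular_values W) y - inner X W)%:E <= g y)%E.
  have := h y; rewrite /= spectral_fun_factored // innerBr {1}WE.
  by rewrite inner_factored // (innerC W).
have gfin : g (singular_values X) \is a fin_num.
  rewrite fin_numElt gN /= ltNge; apply/negP; rewrite leye_eq => /eqP gX.
  by have := h y0; rewrite gX /= leNgt gy0.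
have XW : inner X W = inner (singular_values X) (singular_values W).
  apply/eqP; rewrite eq_le von_neumann /=.
  have := h (singular_values X); rewrite -(fineK gfin) -EFinD lee_fin.
  by rewrite (innerC (singular_values W)); lra.
split=> // y; rewrite innerBr (innerC _ (singular_values X)) -XW.
exact: h.
Qed.

Lemma subgradient_factored g x w U V Y : absolutely_symmetric g ->
  orthogonal_mx U -> orthogonal_mx V -> nonincr_nonneg w ->
  subdifferential g x w ->
  (g (singular_values (U *m rdiag m x *m V^T)) +
    (inner (U *m rdiag m w *m V^T) (Y - U *m rdiag m x *m V^T))%:E <=
    g (singular_values Y))%E.
Proof.
move=> gs UU VV ws xw; rewrite spectral_fun_factored //.
apply: le_trans (xw (singular_values Y)); rewrite leeD2l // lee_fin.
by rewrite !innerBr inner_factored // lerB // von_neumann_factored.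
Qed.

End SingularValues.

(** * Rotating one symmetric matrix onto a nearby one *)

Section Rotation.
Variable R : realType.

Lemma mulmx_rdiagE n p (A : 'M[R]_(p, n)) (d : 'cV[R]_n) i j :
  (A *m rdiag n d) i j = A i j * d j 0.
Proof.
rewrite mxE (bigD1 j) //= mxE eqxx mulr1n big1 ?addr0 // => k kj.
by rewrite mxE (_ : (k == j :> nat) = false) ?mulr0 //; exact/negbTE.
Qed.

Lemma rdiag_mulmxE n p (A : 'M[R]_(n, p)) (d : 'cV[R]_n) i j :
  (rdiag n d *m A) i j = d i 0 * A i j.
Proof.
rewrite (rdiag_mulE (leqnn n)); congr (_ * A _ _); exact: val_inj.
Qed.

Lemma tr_rdiag n (d : 'cV[R]_n) : (rdiag n d)^T = rdiag n d.
Proof.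
apply/matrixP => i j; rewrite !mxE eq_sym.
by have [/val_inj ->|] := eqVneq (i : nat) j.
Qed.

Lemma rdiag1 n : rdiag n (const_mx 1) = 1%:M :> 'M[R]_n.
Proof. by apply/matrixP => i j; rewrite !mxE. Qed.

Lemma commute_rdiag_sqr n (C : 'M[R]_n) (d : 'cV[R]_n) :
  (forall i, 0 <= d i 0) ->
  C *m (rdiag n d *m rdiag n d) = rdiag n d *m rdiag n d *m C ->
  C *m rdiag n d = rdiag n d *m C.
Proof.
move=> d0 CE; apply/matrixP => i j; rewrite mulmx_rdiagE rdiag_mulmxE.
have := congr1 (fun A : 'M[R]_n => A i j) CE.
rewrite mulmxA -(mulmxA _ _ C) !mulmx_rdiagE !rdiag_mulmxE => h.
have [dij|dij] := eqVneq (d i 0 + d j 0) 0.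
  have := d0 i; have := d0 j => hj hi.
  have -> : d i 0 = 0 by lra.
  have -> : d j 0 = 0 by lra.
  by rewrite mulr0 mul0r.
apply: (mulfI dij); move: h; rewrite !mulrA; clear; move=> h.
by rewrite !mulrDl; ring: h.
Qed.

(** The polar decomposition T = P S, read off a singular value decomposition.  The
    factor S is a function of T^T T, hence the commutation property; P is a nearest
    orthogonal matrix to T by von Neumann's inequality. *)
Lemma polar n (T : 'M[R]_n) : exists P S : 'M[R]_n,
  [/\ orthogonal_mx P, T = P *m S,
    forall G, G *m (T^T *m T) = T^T *m T *m G -> G *m S = S *m G &
    forall Q, orthogonal_mx Q -> enorm (P - T) <= enorm (Q - T)].
Proof.
have [U [V [UU VV]]] := singular_values_svd (leqnn n) T.
have := singular_values_nonincr T; set d := singular_values T.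
move: d => d ds TE.
exists (U *m V^T), (V *m rdiag n d *m V^T); split.
- by apply: orthogonalM => //; exact: orthogonal_tr.
- by rewrite !mulmxA -(mulmxA U) VV mulmx1.
- move=> G; have -> : T^T *m T = V *m (rdiag n d *m rdiag n d) *m V^T.
    rewrite TE !trmx_mul trmxK tr_rdiag -!mulmxA.
    by rewrite (mulmxA U^T) UU mul1mx.
  move=> GE; have [C GC] : exists C, G = V *m C *m V^T.
    exists (V^T *m G *m V); rewrite !mulmxA orthogonal_mxT // mul1mx.
    by rewrite -mulmxA orthogonal_mxT // mulmx1.
  have VK A B : V *m A *m V^T *m (V *m B *m V^T) = V *m (A *m B) *m V^T.
    by rewrite !mulmxA -(mulmxA _ V^T) VV mulmx1.
  have VI A B : V *m A *m V^T = V *m B *m V^T -> A = B.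
    move=> /(congr1 (fun M => V^T *m M *m V)).
    by rewrite !mulmxA VV !mul1mx -!mulmxA VV !mulmx1.
  rewrite GC !VK; congr (_ *m _ *m _); apply: commute_rdiag_sqr; first exact: ds.1.
  by move: GE; rewrite GC !VK => /VI.
move=> Q QQ; pose o : 'cV[R]_n := const_mx 1.
have os : nonincr_nonneg o by split=> [i|i j _]; rewrite !mxE.
have PE : U *m V^T = U *m rdiag n o *m V^T by rewrite rdiag1 mulmx1.
have QE : Q = Q *m rdiag n o *m (1%:M)^T by rewrite rdiag1 trmx1 !mulmx1.
rewrite -(@ler_pXn2r _ 2) ?nnegrE ?enorm_ge0 // !sqr_enormB.
rewrite PE {1}QE !enorm_factored //; last exact: orthogonal1.
rewrite lerB // ler_pM2l // {2}TE inner_factored // {1}QE {1}TE.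
by apply: von_neumann_rdiag => //; exact: orthogonal1.
Qed.

(** An intertwining relation of T and of its transpose passes to the orthogonal
    factor: Z then commutes with T^T T, hence with S, and S can be cancelled. *)
Lemma polar_intertwining n (T : 'M[R]_n) : T \in unitmx -> exists P : 'M[R]_n,
  [/\ orthogonal_mx P,
    forall Y Z, Y *m T = T *m Z -> Z *m T^T = T^T *m Y -> Y *m P = P *m Z &
    forall Q, orthogonal_mx Q -> enorm (P - T) <= enorm (Q - T)].
Proof.
move=> Tu; have [P [S [PP TPS Scomm Pmin]]] := polar T.
have Su : S \in unitmx by move: Tu; rewrite TPS unitmx_mul => /andP[].
exists P; split=> // Y Z YT ZT.
have ZS : Z *m S = S *m Z by apply: Scomm; rewrite mulmxA ZT -!mulmxA YT.
apply: (can_inj (mulmxK Su)).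
by rewrite -!mulmxA ZS (mulmxA P) -TPS -YT.
Qed.

Lemma gap_seq (s : seq R) :
  exists2 c : R, 0 < c & forall x, x \in s -> x != 0 -> c <= `|x|.
Proof.
elim: s => [|y s [c c0 cs]]; first by exists 1.
have [->|y0] := eqVneq y 0.
  exists c => // x; rewrite inE => /orP[/eqP->|/cs//]; by rewrite eqxx.
exists (Num.min c `|y|); first by rewrite lt_min c0 normr_gt0.
move=> x; rewrite inE ge_min => /orP[/eqP -> _|/cs xs /xs ->//].
by rewrite lexx orbT.
Qed.

Lemma spectral_gap n (a : 'cV[R]_n) : exists2 c : R, 0 < c &
  forall i k y, y = a k 0 \/ y = - a k 0 -> a i 0 != y -> c <= `|a i 0 - y|.
Proof.
have [c c0 cP] := gap_seq ([seq a i 0 - a k 0 | i <- enum 'I_n, k <- enum 'I_n] ++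
  [seq a i 0 + a k 0 | i <- enum 'I_n, k <- enum 'I_n]).
exists c => // i k y yE; rewrite -subr_eq0; apply: cP; rewrite mem_cat.
case: yE => ->; apply/orP; [left|right; rewrite opprK];
  by apply/allpairsP; exists (i, k); rewrite !mem_enum.
Qed.

(** Written in orthonormal bases of eigenvectors of two symmetric matrices, M being
    the change of basis, this is the sum over the common eigenvalues of the products
    of their spectral projections. *)
Definition eigen_match n (a b : 'cV[R]_n) (M : 'M[R]_n) : 'M[R]_n :=
  \matrix_(i, j) (M i j *+ (a i 0 == b j 0)).

Lemma eigen_match_intertwines n (a b : 'cV[R]_n) (M : 'M[R]_n) :
  rdiag n a *m eigen_match a b M = eigen_match a b M *m rdiag n b.
Proof.
apply/matrixP => i j; rewrite mulmx_rdiagE rdiag_mulmxE mxE.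
by case: eqP => [->|_]; rewrite ?mulr0n ?mul0r ?mulr0 // mulrC.
Qed.

(** The entries of the commutator on the right are those of M multiplied by the
    differences of eigenvalues. *)
Lemma eigen_match_dist n (a b : 'cV[R]_n) (M : 'M[R]_n) (c : R) : 0 < c ->
  (forall i j, a i 0 != b j 0 -> c <= `|a i 0 - b j 0|) ->
  c * enorm (eigen_match a b M - M) <= enorm (M *m rdiag n b - rdiag n a *m M).
Proof.
move=> c0 gap; rewrite -(ger0_norm (ltW c0)) -enormZ.
apply: enorm_le; rewrite !inner_sum.
apply: ler_sum => i _; apply: ler_sum => j _.
have -> : (c *: (eigen_match a b M - M)) i j =
    c * (M i j *+ (a i 0 == b j 0) - M i j) by rewrite !mxE.
have -> : (M *m rdiag n b - rdiag n a *m M) i j = (b j 0 - a i 0) * M i j.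
  by rewrite mxE mulmx_rdiagE mxE rdiag_mulmxE; ring.
have [_|aib] := eqVneq (a i 0) (b j 0).
  by rewrite mulr1n subrr mulr0 mul0r -expr2 sqr_ge0.
have cb := gap i j aib.
rewrite mulr0n sub0r -!expr2 mulrN sqrrN !exprMn.
rewrite ler_wpM2r ?sqr_ge0 // -(real_normK (num_real (b j 0 - _))) distrC.
by rewrite ler_pXn2r ?nnegrE // ltW.
Qed.

Lemma anticommute_rdiag_entry n (G : 'M[R]_n) d i k :
  G *m rdiag n d = - (rdiag n d *m G) -> G i k = 0 \/ d i 0 = - d k 0.
Proof.
move=> /matrixP/(_ i k); rewrite [RHS]mxE mulmx_rdiagE rdiag_mulmxE => h.
have [|G0] := eqVneq (G i k) 0; [by left|right; apply: (mulIf G0)].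
by rewrite mulNr (mulrC (d k 0)) h opprK.
Qed.

(** A matrix anticommuting with a diagonal one only links opposite diagonal entries.
    So on both sides the surviving terms are those with a i = - b j. *)
Lemma eigen_match_anticommute n (a b : 'cV[R]_n) (M G G' : 'M[R]_n) :
  G *m rdiag n a = - (rdiag n a *m G) ->
  G' *m rdiag n b = - (rdiag n b *m G') ->
  G *m M = M *m G' -> G *m eigen_match a b M = eigen_match a b M *m G'.
Proof.
move=> Ga Gb GM; apply/matrixP => i j.
transitivity ((G *m M) i j *+ (a i 0 == - b j 0)).
  rewrite !mxE -sumrMnl; apply: eq_bigr => k _; rewrite mxE.
  case: (anticommute_rdiag_entry i k Ga) => ->; first by rewrite !mul0r mul0rn.
  by rewrite eqr_opp mulrnAr.
rewrite GM !mxE -sumrMnl; apply: eq_bigr => k _; rewrite mxE.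
case: (anticommute_rdiag_entry k j Gb) => ->; first by rewrite !mulr0 mul0rn.
by rewrite mulrnAl.
Qed.

Lemma anticommute_conj n (J B Q : 'M[R]_n) d :
  orthogonal_mx Q -> B = Q *m rdiag n d *m Q^T -> J *m B = - (B *m J) ->
  (Q^T *m J *m Q) *m rdiag n d = - (rdiag n d *m (Q^T *m J *m Q)).
Proof.
move=> QQ BE JB; have -> : rdiag n d = Q^T *m B *m Q.
  by rewrite BE !mulmxA QQ mul1mx -mulmxA QQ mulmx1.
rewrite -!mulmxA (mulmxA Q Q^T) orthogonal_mxT // mul1mx.
rewrite (mulmxA Q Q^T) orthogonal_mxT // mul1mx -mulmxN; congr (_ *m _).
by rewrite !mulmxA JB mulNmx.
Qed.

(** Let A = V D(a) V^T be fixed and A' = O D(b) O^T have all its eigenvalues among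
    those of A and - A.  In these coordinates the identity is M = V^T O; deleting
    the entries of M that do not match equal eigenvalues gives an intertwiner T of
    A' and A, and the deleted part is bounded by A' - A divided by the spectral
    gap.  The orthogonal polar factor of T is still an intertwiner.  Both steps are
    canonical, so the result respects a symmetry J which negates A and A'. *)
Lemma rotation n (V : 'M[R]_n) (a : 'cV[R]_n) : orthogonal_mx V ->
  exists C delta : R, [/\ 0 < C, 0 < delta &
    forall (O : 'M[R]_n) (b : 'cV[R]_n) (A A' : 'M[R]_n), orthogonal_mx O ->
      (forall j, exists k, b j 0 = a k 0 \/ b j 0 = - a k 0) ->
      A = V *m rdiag n a *m V^T -> A' = O *m rdiag n b *m O^T ->
      enorm (A' - A) <= delta ->
    exists P, [/\ orthogonal_mx P, P *m A' = A *m P,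
      enorm (P - 1%:M) <= C * enorm (A' - A) &
      forall J, J^T = J -> J *m A = - (A *m J) -> J *m A' = - (A' *m J) ->
        J *m P = P *m J]].
Proof.
move=> VV; have [c c0 gap] := spectral_gap a.
exists (2 / c), (c / 2); split; rewrite ?divr_gt0 // => O b A A' OO ab AE A'E AA'.
have [M ME] : exists M, M = V^T *m O by exists (V^T *m O).
have MM : orthogonal_mx M.
  by rewrite ME; apply: orthogonalM => //; exact: orthogonal_tr.
have TM : c * enorm (eigen_match a b M - M) <= enorm (A' - A).
  have -> : enorm (A' - A) = enorm (M *m rdiag n b - rdiag n a *m M).
    rewrite -(enorm_orthogonal (_ - _ *m M) VV OO) mulmxBr mulmxBl ME.
    rewrite !mulmxA orthogonal_mxT // mul1mx -(mulmxA _ O O^T) orthogonal_mxT //.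
    by rewrite mulmx1 AE A'E.
  apply: eigen_match_dist => // i j; have [k bk] := ab j.
  exact: gap bk.
have Tab := eigen_match_intertwines a b M.
have GT G G' := @eigen_match_anticommute _ a b M G G'.
move: (eigen_match a b M) TM Tab GT => T TM Tab GT.
have T1 : enorm (T - M) < 1.
  have : c * enorm (T - M) < c * 1.
    by apply: le_lt_trans TM (le_lt_trans AA' _); rewrite mulr1; clear -c0; lra.
  by rewrite ltr_pM2l.
have [P [PP Pint Pmin]] := polar_intertwining (unitmx_near_orthogonal MM T1).
have Pab : rdiag n a *m P = P *m rdiag n b.
  apply: Pint => //; apply: trmx_inj.
  by rewrite !trmx_mul trmxK !tr_rdiag Tab.
exists (V *m P *m O^T); split.
- by do 2?[apply: orthogonalM] => //; exact: orthogonal_tr.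
- rewrite A'E AE -!mulmxA (mulmxA O^T O) OO mul1mx (mulmxA V^T V) VV mul1mx.
  by rewrite (mulmxA P) -Pab !mulmxA.
- have -> : enorm (V *m P *m O^T - 1%:M) = enorm (P - M).
    rewrite -[RHS](enorm_orthogonal (P - M) VV OO) mulmxBr mulmxBl ME.
    by rewrite !mulmxA orthogonal_mxT // mul1mx orthogonal_mxT.
  apply: le_trans (enorm_triangleB T P M) _.
  have Pm := Pmin M MM; rewrite (enorm_distC M) in Pm.
  have : enorm (T - M) <= enorm (A' - A) / c by rewrite ler_pdivlMr // mulrC.
  rewrite (_ : 2 / c * _ = 2 * (enorm (A' - A) / c)); last by ring.
  by move: Pm; clear; lra.
move=> J JT JA JA'.
have Ga := anticommute_conj VV AE JA; have Gb := anticommute_conj OO A'E JA'.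
have GM : V^T *m J *m V *m M = M *m (O^T *m J *m O).
  rewrite ME -!mulmxA (mulmxA V V^T) orthogonal_mxT // mul1mx.
  by rewrite (mulmxA O O^T) orthogonal_mxT // mul1mx.
have GP : V^T *m J *m V *m P = P *m (O^T *m J *m O).
  apply: Pint; first exact: GT Ga Gb GM.
  apply: trmx_inj; rewrite !trmx_mul !trmxK JT !mulmxA.
  by have := GT _ _ Ga Gb GM; rewrite !mulmxA => ->.
have -> : J *m (V *m P *m O^T) = V *m (V^T *m J *m V *m P) *m O^T.
  by rewrite !mulmxA orthogonal_mxT // mul1mx.
by rewrite GP -!mulmxA orthogonal_mxT // mulmx1.
Qed.

End Rotation.

(** * Rotating the factors of a matrix *)

Section FactorRotation.
Variable R : realType.

Lemma mulmx_rdiag n (d e : 'cV[R]_n) :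
  rdiag n d *m rdiag n e = rdiag n (\col_i (d i 0 * e i 0)).
Proof.
apply/matrixP => i j; rewrite mulmx_rdiagE !mxE.
by have [/val_inj ->|_] := eqVneq (i : nat) j; rewrite ?mulr0n ?mul0r.
Qed.

Lemma orthogonal_sign n (e : 'cV[R]_n) :
  (forall i, e i 0 ^+ 2 = 1) -> orthogonal_mx (rdiag n e).
Proof.
move=> e1; rewrite /orthogonal_mx tr_rdiag mulmx_rdiag -rdiag1; congr (rdiag _ _).
by apply/colP => i; rewrite !mxE -expr2 e1.
Qed.

Lemma symmetric_diagonalization n (A : 'M[R]_n) : A^T = A ->
  exists2 V : 'M[R]_n, orthogonal_mx V & exists a, A = V *m rdiag n a *m V^T.
Proof.
move=> AT; have [_ _ AE] := singular_valuesP A.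
have [U [e [UU e1 UE]]] := symmetric_svd AT AE.
exists U => //; exists (\col_i (singular_values A i 0 * e i 0)).
by rewrite -mulmx_rdiag {1}UE trmx_mul tr_rdiag !mulmxA.
Qed.

Lemma enorm_block_diag p q r s (A : 'M[R]_(p, r)) (B : 'M[R]_(q, s)) :
  enorm (block_mx A 0 0 B) ^+ 2 = enorm A ^+ 2 + enorm B ^+ 2.
Proof.
rewrite !sqr_enorm !innerE tr_block_mx !trmx0 mulmx_block.
by rewrite !mul0mx !addr0 !add0r mxtrace_block.
Qed.

Lemma enorm_block_antidiag p q (A : 'M[R]_(p, q)) :
  enorm (block_mx 0 A A^T 0) ^+ 2 = 2 * enorm A ^+ 2.
Proof.
rewrite !sqr_enorm !innerE tr_block_mx !trmx0 trmxK mulmx_block.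
rewrite !mul0mx !addr0 !add0r mxtrace_block (mxtrace_mulC A).
by rewrite mulrDl mul1r.
Qed.

Lemma sqr_le_enorm p q r s (A : 'M[R]_(p, q)) (B : 'M[R]_(r, s)) (c : R) :
  0 <= c -> enorm A ^+ 2 <= (c * enorm B) ^+ 2 -> enorm A <= c * enorm B.
Proof. by move=> c0; rewrite ler_pXn2r ?nnegrE ?mulr_ge0 ?enorm_ge0. Qed.

(** The symmetric dilation of W carries the symmetry diag(1, -1), which negates it;
    a rotation of the dilation commuting with that symmetry is block diagonal, that
    is, a pair of rotations acting on the two sides of W. *)
Lemma rect_rotation n m (W : 'M[R]_(n, m)) :
  exists C delta : R, [/\ 0 < C, 0 < delta &
    forall (F : 'M[R]_n) (G : 'M[R]_m) (W' : 'M[R]_(n, m)),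
      orthogonal_mx F -> orthogonal_mx G -> W' = F *m W *m G^T ->
      enorm (W' - W) <= delta ->
    exists H K, [/\ orthogonal_mx H, orthogonal_mx K, H *m W' *m K^T = W,
      enorm (H - 1%:M) <= C * enorm (W' - W) &
      enorm (K - 1%:M) <= C * enorm (W' - W)]].
Proof.
pose dil (Y : 'M[R]_(n, m)) := block_mx 0 Y Y^T 0.
have dilT : (dil W)^T = dil W by rewrite /dil tr_block_mx !trmx0 trmxK.
have [V VV [a WE]] := symmetric_diagonalization dilT.
have [C [delta [C0 d0 rot]]] := rotation a VV.
exists (C * 2), (delta / 2); split; rewrite ?mulr_gt0 ?divr_gt0 //.
move=> F G W' FF GG W'E W'd.
have dilB : enorm (dil W' - dil W) <= 2 * enorm (W' - W).
  apply: sqr_le_enorm => //; rewrite /dil opp_block_mx add_block_mx subr0.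
  rewrite -raddfB subr0 enorm_block_antidiag exprMn ler_wpM2r ?sqr_ge0 //.
  by clear; lra.
pose O := block_mx F 0 0 G.
have OO : orthogonal_mx O by exact: orthogonal_block.
have dilE : dil W' = (O *m V) *m rdiag (n + m) a *m (O *m V)^T.
  rewrite trmx_mul !mulmxA -(mulmxA O V) -(mulmxA O) -WE /dil /O.
  rewrite tr_block_mx !trmx0 !mulmx_block !mulmx0 !mul0mx !addr0 !add0r.
  by rewrite W'E !trmx_mul trmxK !mulmxA !mul0mx.
have [||P [PP PW Pd PJ]] := rot _ a _ _ (orthogonalM OO VV) _ WE dilE.
- by move=> j; exists j; left.
- by apply: le_trans dilB _; move: W'd; clear; lra.
have := PJ (block_mx 1%:M 0 0 (- 1%:M)).
have JY Y : block_mx 1%:M 0 0 (- 1%:M) *m dil Y =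
    - (dil Y *m block_mx 1%:M 0 0 (- 1%:M)).
  rewrite /dil !mulmx_block opp_block_mx !mulmx0 !mul0mx !addr0 !add0r !oppr0.
  by rewrite !mul1mx !mulmx1 mulmxN mulNmx mulmx1 mul1mx opprK.
have JT : (block_mx 1%:M 0 0 (- 1%:M))^T =
    block_mx 1%:M 0 0 (- 1%:M) :> 'M[R]_(n + m).
  by rewrite tr_block_mx !trmx0 linearN /= !trmx1.
move=> /(_ JT (JY W) (JY W')).
rewrite -[P]submxK !mulmx_block !mulmx0 !mul0mx !addr0 !add0r.
rewrite !mul1mx !mulmx1 mulNmx mulmxN mul1mx mulmx1 => /eq_block_mx[_ ur dl _].
have self_opp p q (Y : 'M[R]_(p, q)) : Y = - Y -> Y = 0.
  move=> /matrixP YE; apply/matrixP => i j; have := YE i j.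
  by rewrite !mxE; clear; lra.
have {ur}ur0 := self_opp _ _ _ ur; have {dl}dl0 := self_opp _ _ _ (esym dl).
have PE : P = block_mx (ulsubmx P) 0 0 (drsubmx P).
  by rewrite -[LHS]submxK ur0 dl0.
move: (ulsubmx P) (drsubmx P) PE => H K PE {ur0 dl0}.
have [HH KK] : orthogonal_mx H /\ orthogonal_mx K.
  move: PP; rewrite /orthogonal_mx PE tr_block_mx !trmx0 mulmx_block.
  rewrite !mulmx0 !mul0mx !addr0 !add0r scalar_mx_block.
  by move=> /eq_block_mx[].
have HW : H *m W' = W *m K.
  move: PW; rewrite PE /dil !mulmx_block !mulmx0 !mul0mx !addr0 !add0r.
  by move=> /eq_block_mx[].
have P1 : enorm (H - 1%:M) ^+ 2 + enorm (K - 1%:M) ^+ 2 = enorm (P - 1%:M) ^+ 2.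
  rewrite PE scalar_mx_block opp_block_mx add_block_mx !oppr0 !addr0.
  by rewrite enorm_block_diag.
have {}Pd : enorm (P - 1%:M) <= C * 2 * enorm (W' - W).
  by apply: le_trans Pd _; rewrite -mulrA ler_pM2l.
exists H, K; split=> //; first by rewrite HW -mulmxA orthogonal_mxT // mulmx1.
- apply: le_trans Pd; rewrite -[leRHS]mul1r; apply: sqr_le_enorm => //.
  by rewrite mul1r -P1 lerDl sqr_ge0.
- apply: le_trans Pd; rewrite -[leRHS]mul1r; apply: sqr_le_enorm => //.
  by rewrite mul1r -P1 lerDr sqr_ge0.
Qed.

(** For symmetric matrices the same rotation must act on both sides; the factored
    matrix may have eigenvalues with other signs than those of W. *)
Lemma symm_rotation n (W : 'M[R]_n) : W^T = W ->
  exists C delta : R, [/\ 0 < C, 0 < delta &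
    forall (U : 'M[R]_n) (e : 'cV[R]_n) (W' : 'M[R]_n),
      orthogonal_mx U -> (forall i, e i 0 ^+ 2 = 1) ->
      W' = U *m rdiag n (singular_values W) *m (U *m rdiag n e)^T ->
      enorm (W' - W) <= delta ->
    exists H, [/\ orthogonal_mx H, H *m W' *m H^T = W &
      enorm (H - 1%:M) <= C * enorm (W' - W)]].
Proof.
move=> WT; have [_ _ /(symmetric_svd WT)[V [f [VV f1 WE]]]] := singular_valuesP W.
move: (singular_values W) WE => w WE.
have WE' : W = V *m rdiag n (\col_i (w i 0 * f i 0)) *m V^T.
  by rewrite -mulmx_rdiag WE trmx_mul tr_rdiag !mulmxA.
have [C [delta [C0 d0 rot]]] := rotation (\col_i (w i 0 * f i 0)) VV.
exists C, delta; split=> // U e W' UU e1 W'E W'd.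
have {}W'E : W' = U *m rdiag n (\col_i (w i 0 * e i 0)) *m U^T.
  by rewrite -mulmx_rdiag W'E trmx_mul tr_rdiag !mulmxA.
have [|H [HH HW Hd _]] := rot U _ _ _ UU _ WE' W'E W'd.
  move=> i; exists i; rewrite !mxE.
  have /eqP : e i 0 ^+ 2 = f i 0 ^+ 2 by rewrite e1 f1.
  by rewrite eqf_sqr => /orP[/eqP->|/eqP->]; [left|right; rewrite mulrN].
by exists H; split=> //; rewrite HW -mulmxA orthogonal_mxT // mulmx1.
Qed.

End FactorRotation.

(** * Metric subregularity *)

Section Subregularity.
Variable R : realType.
Local Open Scope classical_set_scope.

(** A nearest point need not exist, hence the factor two; when v is vbar itself, u
    is already a preimage. *)
Lemma metrically_subregular_elim (U V : euclidType R) (G : U -> set V) ubar vbar :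
  metrically_subregular G ubar vbar ->
  exists delta eps kappa : R, [/\ 0 < delta, 0 < eps, 0 < kappa &
    forall u v, enorm (u - ubar) <= eps -> G u v -> enorm (v - vbar) <= delta ->
      exists2 u', G u' vbar & enorm (u - u') <= kappa * enorm (v - vbar)].
Proof.
move=> [_ [delta [eps [kappa [d0 e0 k0 h]]]]].
exists delta, eps, (2 * kappa); split; rewrite ?mulr_gt0 // => u v ue Guv vd.
have [vE|vv] := eqVneq v vbar.
  exists u; first by rewrite -vE.
  by rewrite vE !subrr !enorm0 mulr0.
have vpos : 0 < enorm (v - vbar).
  rewrite lt_def enorm_ge0 andbT; apply: contra vv => /eqP/enorm0_eq0/eqP.
  by rewrite subr_eq0.
have : (dist u [set u' | G u' vbar] < (2 * kappa * enorm (v - vbar))%:E)%E.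
  apply: le_lt_trans (h u ue) _.
  apply: (@le_lt_trans _ _ (kappa%:E * (enorm (vbar - v))%:E)%E).
    by rewrite lee_pmul2l ?lte_fin //; apply: ereal_inf_lbound; exists v.
  rewrite -EFinM lte_fin enorm_distC -mulrA.
  by rewrite [ltRHS]mulr_natl mulr2n ltrDl mulr_gt0.
move=> /ereal_inf_lt[_ [u' Gu' <-]]; rewrite lte_fin => uu'.
by exists u' => //; exact: ltW.
Qed.

Lemma metrically_subregular_intro (U V : euclidType R) (G : U -> set V) ubar vbar
    (delta eps kappa : R) :
  G ubar vbar -> 0 < delta -> 0 < eps -> 0 < kappa ->
  (forall u v, enorm (u - ubar) <= eps -> G u v -> enorm (v - vbar) <= delta ->
    exists2 u', G u' vbar & enorm (u - u') <= kappa * enorm (v - vbar)) ->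
  metrically_subregular G ubar vbar.
Proof.
move=> Gbar d0 e0 k0 h; split=> //; exists delta, eps, kappa; split=> // u ue.
rewrite -lee_pdivrMl //; apply: le_ereal_inf_tmp => _ [v [Guv vd] <-].
have [u' Gu' uu'] := h u v ue Guv vd.
rewrite lee_pdivrMl // -EFinM (enorm_distC vbar).
apply: (@le_trans _ _ (enorm (u - u'))%:E); last by rewrite lee_fin.
by apply: ereal_inf_lbound; exists u'.
Qed.

(** The transfer of subregularity.  Let X and W have the common factors U, V, with
    x and w the singular values of X and of Wbar.  Subregularity in R^n moves x to
    some x' in the preimage of w, and U D(w) V^T is within twice the distance of W
    from Wbar.  It differs from Wbar by rotations near the identity, which carry
    U D(x') V^T to the point sought.  The predicate adm collects the pairs of
    factors allowed: all orthogonal pairs, or those of symmetric matrices. *)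
Lemma subregular_transfer n m (nm : (n <= m)%N) (g : 'cV[R]_n -> \bar R)
    (adm : 'M[R]_n -> 'M[R]_m -> Prop) (Xbar Wbar : 'M[R]_(n, m)) :
  let w := singular_values Wbar in
  (forall U V, adm U V -> orthogonal_mx U /\ orthogonal_mx V) ->
  metrically_subregular (subdifferential g) (singular_values Xbar) w ->
  (exists C delta : R, [/\ 0 < C, 0 < delta &
    forall U V (W' : 'M[R]_(n, m)), adm U V -> W' = U *m rdiag m w *m V^T ->
      enorm (W' - Wbar) <= delta ->
    exists H K, [/\ orthogonal_mx K, adm (H *m U) (K *m V),
      H *m W' *m K^T = Wbar, enorm (H - 1%:M) <= C * enorm (W' - Wbar) &
      enorm (K - 1%:M) <= C * enorm (W' - Wbar)]]) ->
  exists delta eps kappa : R, [/\ 0 < delta, 0 < eps, 0 < kappa &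
    forall X W U V, adm U V ->
      X = U *m rdiag m (singular_values X) *m V^T ->
      W = U *m rdiag m (singular_values W) *m V^T ->
      subdifferential g (singular_values X) (singular_values W) ->
      enorm (X - Xbar) <= eps -> enorm (W - Wbar) <= delta ->
    exists x' U' V', [/\ adm U' V', Wbar = U' *m rdiag m w *m V'^T,
      subdifferential g x' w &
      enorm (X - U' *m rdiag m x' *m V'^T) <= kappa * enorm (W - Wbar)]].
Proof.
move=> w adm_orth /metrically_subregular_elim[d1 [eps [k [d10 eps0 k0 sub]]]].
move=> [C [d2 [C0 d20 rot]]].
pose M := enorm Xbar + eps + k * d1.
have M0 : 0 < M by rewrite addr_gt0 ?mulr_gt0 // ltr_wpDl ?enorm_ge0.
pose delta := Num.min d1 (d2 / 2).
(* The singular values account for k.  The rotations move the point by at most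
   2 C |W' - Wbar| M, where |W' - Wbar| is at most 2 |W - Wbar| and M bounds the
   norm of the point. *)
exists delta, eps, (k + 4 * C * M); split=> //.
- by rewrite lt_min d10 divr_gt0.
- by rewrite addr_gt0 // !mulr_gt0.
move=> X W U V UV XE WE gXW Xd; rewrite le_min => /andP[Wd1 Wd2].
have [UU VV] := adm_orth U V UV.
set t := enorm (W - Wbar) in Wd1 Wd2 *.
have t0 : 0 <= t by exact: enorm_ge0.
have ws : enorm (singular_values W - w) <= t by exact: singular_values_lipschitz.
have [||x' gx' xx'] := sub (singular_values X) (singular_values W) _ gXW.
- exact: le_trans (singular_values_lipschitz nm _ _) Xd.
- exact: le_trans ws Wd1.
have {}xx' : enorm (singular_values X - x') <= k * t.
  by apply: le_trans xx' _; rewrite ler_pM2l.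
have x'M : enorm x' <= M.
  have Xn : enorm X <= enorm Xbar + eps.
    have := enorm_triangle Xbar (X - Xbar); rewrite addrC subrK => Xn.
    by apply: le_trans Xn _; rewrite lerD2l.
  have := enorm_triangle (singular_values X) (- (singular_values X - x')).
  rewrite enormN opprB addrC subrK enorm_singular_values // => x'n.
  apply: le_trans x'n _; rewrite lerD // (le_trans xx') // ler_pM2l //.
pose W' := U *m rdiag m w *m V^T; pose X' := U *m rdiag m x' *m V^T.
have W'd : enorm (W' - Wbar) <= 2 * t.
  apply: le_trans (enorm_triangleB W W' Wbar) _; rewrite -/t enorm_distC.
  rewrite {1}WE enorm_factoredB //.
  by move: ws; clear; lra.
have [|H [K [KK HK HW H1 K1]]] := rot U V W' UV erefl.
  by apply: le_trans W'd _; move: Wd2; clear; lra.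
exists x', (H *m U), (K *m V); split=> //.
  by rewrite -HW /W' trmx_mul !mulmxA.
have -> : H *m U *m rdiag m x' *m (K *m V)^T = H *m X' *m K^T.
  by rewrite /X' trmx_mul !mulmxA.
apply: le_trans (enorm_triangleB X' X _) _.
have XX' : enorm (X - X') <= k * t by rewrite {1}XE enorm_factoredB.
have X'n : enorm X' <= M by rewrite enorm_factored.
have Ct : C * enorm (W' - Wbar) <= C * (2 * t) by rewrite ler_pM2l.
have HX : enorm ((H - 1%:M) *m X') <= C * (2 * t) * M.
  apply: le_trans (enorm_mulmx _ _) _.
  by rewrite ler_pM ?enorm_ge0 // (le_trans H1).
have KX : enorm (X' *m (K - 1%:M)) <= C * (2 * t) * M.
  apply: le_trans (enorm_mulmx _ _) _; rewrite mulrC.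
  by rewrite ler_pM ?enorm_ge0 // (le_trans K1).
have rotated : enorm (X' - H *m X' *m K^T) <= C * (2 * t) * M + C * (2 * t) * M.
  rewrite enorm_distC.
  have -> : enorm (H *m X' *m K^T - X') =
      enorm ((H - 1%:M) *m X' - X' *m (K - 1%:M)).
    have -> : (H - 1%:M) *m X' - X' *m (K - 1%:M) = H *m X' - X' *m K.
      by rewrite mulmxBl mul1mx mulmxBr mulmx1 opprB addrA subrK.
    rewrite -[RHS](enorm_orthogonalr _ (orthogonal_tr KK)) mulmxBl -(mulmxA X').
    by rewrite orthogonal_mxT // mulmx1.
  apply: le_trans (enorm_triangle _ _) _; rewrite enormN.
  exact: lerD.
apply: le_trans (lerD XX' rotated) _.
by rewrite le_eqVlt; apply/orP; left; apply/eqP; ring.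
Qed.


Lemma symm_tr n (X : symmx R n) : (vsval X)^T = vsval X.
Proof. exact/symm_spaceP/subvsP. Qed.

Lemma symm_lift n (A : 'M[R]_n) : A^T = A -> exists X : symmx R n, vsval X = A.
Proof. by move=> /symm_spaceP AS; exists (Subvs AS). Qed.

Lemma enorm_symmB n (X Y : symmx R n) : enorm (X - Y) = enorm (vsval X - vsval Y).
Proof. by rewrite -linearB. Qed.

Lemma inner_symmB n (W X Y : symmx R n) :
  inner W (Y - X) = inner (vsval W) (vsval Y - vsval X).
Proof. by rewrite -linearB. Qed.

Lemma symm_factored n (U : 'M[R]_n) (e y : 'cV[R]_n) :
  (U *m rdiag n y *m (U *m rdiag n e)^T)^T = U *m rdiag n y *m (U *m rdiag n e)^T.
Proof.
rewrite !trmx_mul !trmxK !tr_rdiag -!mulmxA; congr (_ *m _).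
rewrite !mulmxA !mulmx_rdiag; congr (rdiag _ _ *m _).
by apply/colP => i; rewrite !mxE mulrC.
Qed.

Lemma subregular_spectral n m (nm : (n <= m)%N) (g : 'cV[R]_n -> \bar R)
    (Xbar Wbar : 'M[R]_(n, m)) :
  proper_fun g -> absolutely_symmetric g ->
  subdifferential (spectral_fun (m := m) g) Xbar Wbar ->
  metrically_subregular (subdifferential g)
    (singular_values Xbar) (singular_values Wbar) ->
  metrically_subregular (subdifferential (spectral_fun (m := m) g)) Xbar Wbar.
Proof.
move=> g_proper g_sym XWbar sub.
pose adm (U : 'M[R]_n) (V : 'M[R]_m) := orthogonal_mx U /\ orthogonal_mx V.
have rot : exists C delta : R, [/\ 0 < C, 0 < delta &
    forall U V (W' : 'M[R]_(n, m)), adm U V ->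
      W' = U *m rdiag m (singular_values Wbar) *m V^T ->
      enorm (W' - Wbar) <= delta ->
    exists H K, [/\ orthogonal_mx K, adm (H *m U) (K *m V),
      H *m W' *m K^T = Wbar, enorm (H - 1%:M) <= C * enorm (W' - Wbar) &
      enorm (K - 1%:M) <= C * enorm (W' - Wbar)]].
  have [C [delta [C0 d0 rot]]] := rect_rotation Wbar.
  have [U0 [V0 [UU0 VV0 WE0]]] := singular_values_svd nm Wbar.
  exists C, delta; split=> // U V W' [UU VV] W'E W'd.
  have [|||H [K [HH KK HW H1 K1]]] := rot (U *m U0^T) (V *m V0^T) W' _ _ _ W'd.
  - by apply: orthogonalM => //; exact: orthogonal_tr.
  - by apply: orthogonalM => //; exact: orthogonal_tr.
  - rewrite W'E [in RHS]WE0 trmx_mul trmxK !mulmxA -(mulmxA U U0^T) UU0 mulmx1.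
    by rewrite -(mulmxA _ V0^T) VV0 mulmx1.
  by exists H, K; split=> //; split; exact: orthogonalM.
have [delta [eps [kappa [d0 e0 k0 transfer]]]] :=
  @subregular_transfer _ _ nm g adm Xbar Wbar (fun _ _ UV => UV) sub rot.
apply: (metrically_subregular_intro XWbar d0 e0 k0) => X W Xd XW Wd.
have [U0 [V0 [UU0 VV0 WE0]]] := singular_values_svd nm W.
have [gXW XWE] := subgradient_singular_values nm g_proper g_sym UU0 VV0 WE0
  (fun y => XW _).
have [U [V [UU VV ZE]]] := singular_values_svd nm (X + W).
have [XE WE] := simultaneous_svd nm UU VV XWE ZE.
have [x' [U' [V' [[UU' VV'] WbarE gx' Xx']]]] :=
  transfer X W U V (conj UU VV) XE WE gXW Xd Wd.
exists (U' *m rdiag m x' *m V'^T) => // Y.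
rewrite {1}WbarE; apply: subgradient_factored => //.
exact: singular_values_nonincr.
Qed.

(** Subgradients are tested on symmetric matrices only.  The matrices tested are
    diagonal in the bases U, U D(e) of W, and the rotation acts on both sides
    alike; this keeps everything symmetric. *)
Lemma subregular_spectral_symm n (g : 'cV[R]_n -> \bar R) (Xbar Wbar : symmx R n) :
  proper_fun g -> absolutely_symmetric g ->
  subdifferential (spectral_fun_symm g) Xbar Wbar ->
  metrically_subregular (subdifferential g)
    (singular_values (vsval Xbar)) (singular_values (vsval Wbar)) ->
  metrically_subregular (subdifferential (spectral_fun_symm g)) Xbar Wbar.
Proof.
move=> g_proper g_sym XWbar sub.
pose adm (U V : 'M[R]_n) := orthogonal_mx U /\
  exists2 e : 'cV[R]_n, forall i, e i 0 ^+ 2 = 1 & V = U *m rdiag n e.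
have adm_orth U V : adm U V -> orthogonal_mx U /\ orthogonal_mx V.
  move=> [UU [e e1 ->]]; split=> //.
  by apply: orthogonalM => //; exact: orthogonal_sign.
have svd_adm (A : 'M[R]_n) : A^T = A -> exists2 UV : 'M[R]_n * 'M[R]_n,
    adm UV.1 UV.2 & A = UV.1 *m rdiag n (singular_values A) *m UV.2^T.
  move=> AT; have [_ _ AE] := singular_valuesP A.
  have [U [e [UU e1 UE]]] := symmetric_svd AT AE.
  by exists (U, U *m rdiag n e) => //; split=> //; exists e.
have lift_adm U V y : adm U V ->
    exists Y : symmx R n, vsval Y = U *m rdiag n y *m V^T.
  by move=> [_ [e _ ->]]; apply: symm_lift; exact: symm_factored.
have rot : exists C delta : R, [/\ 0 < C, 0 < delta &
    forall U V (W' : 'M[R]_n), adm U V ->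
      W' = U *m rdiag n (singular_values (vsval Wbar)) *m V^T ->
      enorm (W' - vsval Wbar) <= delta ->
    exists H K, [/\ orthogonal_mx K, adm (H *m U) (K *m V),
      H *m W' *m K^T = vsval Wbar,
      enorm (H - 1%:M) <= C * enorm (W' - vsval Wbar) &
      enorm (K - 1%:M) <= C * enorm (W' - vsval Wbar)]].
  have [C [delta [C0 d0 rot]]] := symm_rotation (symm_tr Wbar).
  exists C, delta; split=> // U V W' [UU [e e1 VE]] W'E W'd.
  rewrite VE in W'E; have [H [HH HW H1]] := rot U e W' UU e1 W'E W'd.
  exists H, H; split=> //; split; first exact: orthogonalM.
  by exists e => //; rewrite VE mulmxA.
have [delta [eps [kappa [d0 e0 k0 transfer]]]] :=
  @subregular_transfer _ _ (leqnn n) g adm (vsval Xbar) (vsval Wbar)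
    adm_orth sub rot.
apply: (metrically_subregular_intro XWbar d0 e0 k0) => X W.
rewrite !enorm_symmB => Xd XW Wd.
have [[U0 V0] /= UV0 WE0] := svd_adm _ (symm_tr W).
have [UU0 VV0] := adm_orth _ _ UV0.
have [y|gXW XWE] :=
    @subgradient_singular_values _ _ _ (leqnn n) g (vsval X) _ _ _
      g_proper g_sym UU0 VV0 WE0.
  have [Y YE] := lift_adm _ _ y UV0.
  by have := XW Y; rewrite /spectral_fun_symm inner_symmB YE.
have ZT : (vsval X + vsval W)^T = vsval X + vsval W.
  by rewrite [LHS]linearD /= !symm_tr.
have [[U V] /= UV ZE] := svd_adm _ ZT.
have [UU VV] := adm_orth _ _ UV.
have [XE WE] := simultaneous_svd (leqnn n) UU VV XWE ZE.
have [x' [U' [V' [UV' WbarE gx' Xx']]]] := transfer _ _ U V UV XE WE gXW Xd Wd.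
have [X' X'E] := lift_adm _ _ x' UV'.
exists X'; last by rewrite enorm_symmB X'E.
move=> Y; rewrite /spectral_fun_symm inner_symmB X'E {1}WbarE.
have [UU' VV'] := adm_orth _ _ UV'.
apply: subgradient_factored => //; exact: singular_values_nonincr.
Qed.

End Subregularity.

Theorem proposition14 (R : realType) (n : nat) (g : 'cV[R]_n -> \bar R)
    (g_proper : proper_fun g) (g_closed : closed_fun g)
    (g_convex : convex_fun g) (g_sym : absolutely_symmetric g) :
  (forall (m : nat) (X W : 'M[R]_(n, m)), (n <= m)%N ->
     subdifferential (spectral_fun (m := m) g) X W ->
     metrically_subregular (subdifferential g)
       (singular_values X) (singular_values W) ->
     metrically_subregular (subdifferential (spectral_fun (m := m) g)) X W)
  /\
  (forall X W : symmx R n,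
     subdifferential (spectral_fun_symm g) X W ->
     metrically_subregular (subdifferential g)
       (singular_values (vsval X)) (singular_values (vsval W)) ->
     metrically_subregular (subdifferential (spectral_fun_symm g)) X W).
Proof.
split=> [m X W nm|X W].
  exact: subregular_spectral.
exact: subregular_spectral_symm.
Qed.
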